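(* It is not possible in general to put fiber-circles over each point of a virtual 2-knot diagram in a consistent way so as to make a one-dimensional-higher tube. That is, it is not true that for every virtual 2-knot diagram $\alpha$, given by a generic map $f:F\to\mathbb R^3$ with crossing data, there is a fiber-circle covering of $\alpha$, i.e. an embedding $\varphi:F\times S^1\hookrightarrow\mathbb R^3\times\mathbb R^2$ with $\varphi(\{x\}\times S^1)\subset\{f(x)\}\times\mathbb R^2$ for all $x\in F$, such that whenever $x\ne y$ and $f(x)=f(y)$: if the double point is classical, the circle of the upper sheet encloses the circle of the lower sheet in the fiber plane; if the double point is virtual, each of the two circles lies outside the other.
   Context: Smooth category. A smooth map $f:F\to\mathbb R^3$ of a closed surface is generic if its only singularities are transverse double-point arcs, transverse triple points, and isolated Whitney branch points (locally the cone over a figure-$\infty$ curve). A virtual 2-knot diagram is such a generic map with each double-point arc marked classical (with over/under information) or virtual; a branch point is classical or virtual according to the double-point arc ending there. Allowed triple points are: all three crossing arcs classical with consistent top/middle/bottom sheets; all three virtual; or one classical and two virtual. In a fiber-circle covering, each $\mu$-tuple point of the diagram ($\mu=0,1,2,3$) has exactly $\mu$ circles in the fiber plane $\mathbb R^2$ over it, with relative positions given pairwise by the classical/virtual rule in the claim (a branch point has one circle over it). *)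

(* Defs.v *)
From HB Require Import structures.
From mathcomp Require Import all_boot all_order all_algebra.
From mathcomp Require Import all_classical all_reals all_analysis.

Set Implicit Arguments.
Unset Strict Implicit.
Unset Printing Implicit Defensive.

Import Order.TTheory GRing.Theory Num.Theory.
Import numFieldNormedType.Exports.

Local Open Scope classical_set_scope.
Local Open Scope ring_scope.

Section smoothness.
Context {R : realType}.

(* C^k for finite-dimensional V, through iterated directional derivatives in
   constant directions.  Meaningful for open A only. *)
Fixpoint Ck (k : nat) (V W : normedModType R) (A : set V) (f : V -> W) : Prop :=
  (forall x, A x -> {for x, continuous f}) /\
  match k with
  | 0 => True
  | k'.+1 => forall v : V,
      (forall x, A x -> derivable f x v) /\ Ck k' A (fun x => 'D_v f x)
  end.

Definition smooth_on (V W : normedModType R) (A : set V) (f : V -> W) : Prop :=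
  forall k, Ck k A f.

Definition immersive_at (V W : normedModType R) (f : V -> W) (x : V) : Prop :=
  forall v : V, 'D_v f x = 0 -> v = 0.

Definition diffeomorphism (V W : normedModType R) (A : set V) (B : set W)
    (h : V -> W) (g : W -> V) : Prop :=
  [/\ open A /\ open B,
      (forall x, A x -> B (h x)) /\ (forall y, B y -> A (g y)),
      (forall x, A x -> g (h x) = x) /\ (forall y, B y -> h (g y) = y) &
      smooth_on A h /\ smooth_on B g].

End smoothness.

Section surfaces.
Variable R : realType.

(* The values of [cto] outside [cdom] and of [cfrom] outside [ccod] are
   irrelevant. *)
Record chart (F : topologicalType) := Chart {
  cdom : set F;
  ccod : set 'rV[R]_2;
  cto : F -> 'rV[R]_2;
  cfrom : 'rV[R]_2 -> F;
  chart_open_dom : open cdom;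
  chart_open_cod : open ccod;
  chart_to_cod : forall x, cdom x -> ccod (cto x);
  chart_from_dom : forall u, ccod u -> cdom (cfrom u);
  chart_toK : forall x, cdom x -> cfrom (cto x) = x;
  chart_fromK : forall u, ccod u -> cto (cfrom u) = u;
  chart_to_continuous : forall x, cdom x -> {for x, continuous cto};
  chart_from_continuous : forall u, ccod u -> {for u, continuous cfrom} }.

(* Second countability follows from compactness and the charts. *)
Record closed_surface := ClosedSurface {
  surface_space :> topologicalType;
  surface_hausdorff : hausdorff_space surface_space;
  surface_compact : compact [set: surface_space];
  atlas : set (chart surface_space);
  atlas_cover : forall x, exists2 a, atlas a & cdom a x;
  atlas_smooth : forall a b, atlas a -> atlas b ->
    smooth_on [set u | ccod a u /\ cdom b (cfrom a u)] (cto b \o cfrom a) }.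

Section generic_maps.
Variables (F : closed_surface) (f : F -> 'rV[R]_3).

Definition smooth_surface_map : Prop :=
  forall a, atlas a -> smooth_on (ccod a) (f \o cfrom a).

Definition immersed_at (x : F) : Prop :=
  forall a, atlas a -> cdom a x -> immersive_at (f \o cfrom a) (cto a x).

(* The image of the differential of f at x. *)
Definition tangent_image (x : F) : set 'rV[R]_3 :=
  [set w | exists a, [/\ atlas a, cdom a x &
             exists v, w = 'D_v (f \o cfrom a) (cto a x)]].

(* (s, t) |-> (s t, s, t^2) *)
Definition whitney_umbrella (u : 'rV[R]_2) : 'rV[R]_3 :=
  let s := u ord0 ord0 in
  let t := u ord0 ord_max in
  \row_(i < 3) [:: s * t; s; t ^+ 2]`_i.

Definition whitney_branch_point (x : F) : Prop :=
  exists a, [/\ atlas a, cdom a x &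
    exists (U U' : set 'rV[R]_2) (h h' : 'rV[R]_2 -> 'rV[R]_2)
           (V V' : set 'rV[R]_3) (k k' : 'rV[R]_3 -> 'rV[R]_3),
      [/\ diffeomorphism U U' h h' /\ diffeomorphism V V' k k',
          U `<=` ccod a,
          U (cto a x) /\ h (cto a x) = 0,
          V (f x) /\ k (f x) = 0 &
          forall u, U u -> V (f (cfrom a u)) /\
                           k (f (cfrom a u)) = whitney_umbrella (h u)]].

Definition double_pair (x y : F) : Prop := x <> y /\ f x = f y.

Definition triple_tuple (x y z : F) : Prop :=
  [/\ double_pair x y, double_pair x z & double_pair y z].

Record generic_map : Prop := GenericMap {
  generic_smooth : smooth_surface_map;
  generic_point : forall x, immersed_at x \/ whitney_branch_point x;
  generic_double : forall x y, double_pair x y ->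
    [/\ immersed_at x, immersed_at y &
        forall w, exists v1 v2, [/\ tangent_image x v1, tangent_image y v2 &
                                    w = v1 + v2]];
  generic_triple : forall x y z, triple_tuple x y z ->
    forall w, tangent_image x w -> tangent_image y w -> tangent_image z w ->
      w = 0;
  generic_no_quadruple : forall x y z t, triple_tuple x y z ->
    ~ [/\ double_pair x t, double_pair y t & double_pair z t] }.

End generic_maps.

End surfaces.

(* Mark of an ordered pair (x, y) of points with the same image: [Over] means
   that the sheet at x passes over the sheet at y. *)
Inductive crossing := Over | Under | Virtual.

Definition crossing_flip (c : crossing) : crossing :=
  match c with Over => Under | Under => Over | Virtual => Virtual end.

Section diagrams.
Variable R : realType.

Definition allowed_triple (T : eqType) (mark : T -> T -> crossing)
    (x y z : T) : Prop :=
  exists t m b, perm_eq [:: t; m; b] [:: x; y; z] /\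
    [\/ [/\ mark t m = Over, mark m b = Over & mark t b = Over],
        [/\ mark t m = Virtual, mark m b = Virtual & mark t b = Virtual] |
        [/\ mark t m = Over, mark m b = Virtual & mark t b = Virtual]].

(* A double-point arc lifts to the set of pairs (x, y), x <> y, f x = f y,
   which is a 1-manifold even over triple points; marking the arcs amounts to
   a locally constant mark on that set.  The values of [mark] elsewhere are
   irrelevant. *)
Record virtual_2knot_diagram := Virtual2KnotDiagram {
  surface : closed_surface R;
  dmap : surface -> 'rV[R]_3;
  dmap_generic : generic_map dmap;
  mark : surface -> surface -> crossing;
  mark_flip : forall x y, double_pair dmap x y ->
    mark y x = crossing_flip (mark x y);
  mark_locally_constant : forall x y, double_pair dmap x y ->
    \forall p \near (x, y), double_pair dmap p.1 p.2 ->
      mark p.1 p.2 = mark x y;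
  mark_triple : forall x y z, triple_tuple dmap x y z ->
    allowed_triple mark x y z }.

(* Union of the bounded, resp. unbounded, components of the complement. *)
Definition inside (C : set 'rV[R]_2) : set 'rV[R]_2 :=
  [set z | ~ C z /\ bounded_set (connected_component (~` C) z)].

Definition outside (C : set 'rV[R]_2) : set 'rV[R]_2 :=
  [set z | ~ C z /\ ~ bounded_set (connected_component (~` C) z)].

Definition circle : set 'rV[R]_2 :=
  [set s | s ord0 ord0 ^+ 2 + s ord0 ord_max ^+ 2 = 1].

Definition angle (t : R) : 'rV[R]_2 :=
  \row_(i < 2) [:: cos t; sin t]`_i.

(* A map on F x S^1 is represented by a total map on F x R^2, of which only the
   restriction to F x S^1 matters.  Smoothness and immersivity are read in the
   charts of F times the local coordinate t |-> angle t of S^1. *)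
Record tube_embedding (F : closed_surface R)
    (phi : F * 'rV[R]_2 -> 'rV[R]_3 * 'rV[R]_2) : Prop := TubeEmbedding {
  tube_smooth : forall a : chart R F, atlas a ->
    smooth_on [set p : 'rV[R]_2 * R | ccod a p.1]
      (fun p : 'rV[R]_2 * R => phi (cfrom a p.1, angle p.2));
  tube_immersion : forall (a : chart R F) u t, atlas a -> ccod a u ->
    immersive_at (fun p : 'rV[R]_2 * R => phi (cfrom a p.1, angle p.2)) (u, t);
  tube_injective : set_inj ([set: F] `*` circle) phi;
  (* the inverse is continuous on the image *)
  tube_homeomorphism : forall p, ([set: F] `*` circle) p ->
    forall U, nbhs p U -> \forall q \near phi p,
      forall p', ([set: F] `*` circle) p' -> phi p' = q -> U p' }.

Definition fiber_circle (F : closed_surface R)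
    (phi : F * 'rV[R]_2 -> 'rV[R]_3 * 'rV[R]_2) (x : F) : set 'rV[R]_2 :=
  [set (phi (x, s)).2 | s in circle].

Record fiber_circle_covering (alpha : virtual_2knot_diagram)
    (phi : surface alpha * 'rV[R]_2 -> 'rV[R]_3 * 'rV[R]_2) : Prop :=
  FiberCircleCovering {
  covering_embedding : tube_embedding phi;
  covering_fiber : forall x s, circle s -> (phi (x, s)).1 = dmap x;
  covering_classical : forall x y, double_pair (@dmap alpha) x y ->
    mark x y = Over -> fiber_circle phi y `<=` inside (fiber_circle phi x);
  covering_virtual : forall x y, double_pair (@dmap alpha) x y ->
    mark x y = Virtual ->
    fiber_circle phi x `<=` outside (fiber_circle phi y) /\
    fiber_circle phi y `<=` outside (fiber_circle phi x) }.

End diagrams.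

(* Main.v *)
From HB Require Import structures.
Require Import Defs.
From mathcomp Require Import all_boot all_order all_algebra.
From mathcomp Require Import all_classical all_reals all_analysis.
From mathcomp Require Import ring lra.

Set Implicit Arguments.
Unset Strict Implicit.
Unset Printing Implicit Defensive.

Import Order.TTheory GRing.Theory Num.Theory.
Import numFieldNormedType.Exports.

Local Open Scope classical_set_scope.
Local Open Scope ring_scope.

(** The obstruction sits at a virtual branch point.  Near a Whitney branch point
    the two preimages of a double point merge; if the double arc is virtual, the
    two fiber circles over it lie outside each other, and yet both converge
    uniformly to the single embedded circle C over the branch point.  A point z
    about which C winds once is wound once by both neighbouring circles, so it is
    inside both of them, whereas two disjoint closed sets, each contained in
    the outside of the other, have no common inside point
    ([mutually_outside_insides]).

    The diagram is the unit sphere mapped by (x, y, z) |-> (x y, y, z): every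
    horizontal circle becomes a figure eight, the double points are the pairs
    (x, 0, z), (- x, 0, z) with x <> 0, there are no triple points, and the two
    poles are branch points ([pinched_sphere_generic]).  All double points are
    marked virtual.  In stereographic coordinates the sphere, the map and the
    coordinate changes to Whitney's normal form are rational functions, so that
    smoothness reduces to closure of C^k under sums, products and inverses.

    Winding numbers are needed only modulo 2, where they have an elementary
    description: a loop in the punctured plane winds an even number of times iff
    it has a continuous periodic complex square root ([even_winding]).  This parity
    is stable under perturbation ([even_winding_near]), hence constant on the
    components of the complement of a loop, and even on unbounded ones
    ([even_winding_unbounded]).  It is odd about a point slightly to the left of the
    rightmost point of an embedded regular loop: the horizontal ray from that
    point to the right meets the loop exactly once, transversally
    ([embedded_loop_odd_winding]).  Regularity of C comes from the tube
    being an immersion: its first component is constant along fibers, so the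
    second one carries the whole velocity. *)

(** * Periodic square roots: winding numbers modulo 2 *)

Section square_roots.
Context {R : realType}.
Implicit Types x y a b : R -> R.

(** The loop x + iy has the continuous periodic square root a + ib.  For a loop
    avoiding 0 this says that its winding number about 0 is even. *)
Definition has_sqrt x y := exists a b,
  [/\ continuous a /\ continuous b,
      periodic a (pi *+ 2) /\ periodic b (pi *+ 2) &
      forall t, a t ^+ 2 - b t ^+ 2 = x t /\ 2 * a t * b t = y t].

(** A positive scalar product keeps the quotient of the two loops in the right
    half-plane, where the principal square root is continuous.  With
    p + iq = (x' + iy') (x - iy) and m = |x + iy|, the product of the root of
    x + iy by the principal root of p + iq squares to (x' + iy') m^2. *)
Lemma has_sqrt_stable x y x' y' :
  continuous x -> continuous y -> continuous x' -> continuous y' ->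
  periodic x (pi *+ 2) -> periodic y (pi *+ 2) ->
  periodic x' (pi *+ 2) -> periodic y' (pi *+ 2) ->
  (forall t, 0 < x t * x' t + y t * y' t) ->
  has_sqrt x y -> has_sqrt x' y'.
Proof.
move=> cx cy cx' cy' px py px' py' dot [a [b [[ca cb] [pa pb] ab]]].
pose p t := x t * x' t + y t * y' t.
pose q t := x t * y' t - y t * x' t.
pose n t : R := Num.sqrt (p t ^+ 2 + q t ^+ 2).
pose m t : R := Num.sqrt (x t ^+ 2 + y t ^+ 2).
pose c t : R := Num.sqrt ((n t + p t) / 2).
pose d t := q t / (2 * c t).
have cp : continuous p.
  move=> t; apply: cvgD; apply: cvgM; by [apply: cx|apply: cx'|apply: cy|apply: cy'].
have cq : continuous q.
  move=> t; apply: cvgB; apply: cvgM; by [apply: cx|apply: cx'|apply: cy|apply: cy'].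
have csq (f g : R -> R) : continuous f -> continuous g ->
    continuous (fun t : R => Num.sqrt (f t ^+ 2 + g t ^+ 2) : R).
  move=> cf cg t; apply: (@continuous_comp _ _ _ (fun t : R => f t ^+ 2 + g t ^+ 2 : R)).
    by apply: cvgD; rewrite /GRing.exp/=; apply: cvgM; by [apply: cf|apply: cg].
  exact: sqrt_continuous.
have cn : continuous n by exact: csq.
have cm : continuous m by exact: csq.
have n0 t : 0 <= n t by rewrite sqrtr_ge0.
have c0 t : 0 < c t.
  by rewrite sqrtr_gt0 divr_gt0//; have := n0 t; have := dot t; rewrite -/(p t); lra.
have m0 t : 0 < m t.
  rewrite sqrtr_gt0 lt_neqAle addr_ge0 ?sqr_ge0// andbT eq_sym paddr_eq0 ?sqr_ge0//.
  rewrite !sqrf_eq0; apply/negP => /andP[/eqP x0 /eqP y0].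
  by have := dot t; rewrite x0 y0 !mul0r addr0 ltxx.
have cc : continuous c.
  move=> t; apply: (@continuous_comp _ _ _ (fun t : R => (n t + p t) / 2 : R)).
    by apply: cvgM; [apply: cvgD; [apply: cn|apply: cp]|exact: cvg_cst].
  exact: sqrt_continuous.
have cd : continuous d.
  move=> t; apply: cvgM; first exact: cq.
  apply: cvgV; first by rewrite mulf_neq0// gt_eqF// c0.
  by apply: cvgM; [exact: cvg_cst|exact: cc].
have pp t : p (t + pi *+ 2) = p t by rewrite /p px py px' py'.
have pq t : q (t + pi *+ 2) = q t by rewrite /q px py px' py'.
have pm t : m (t + pi *+ 2) = m t by rewrite /m px py.
have pc t : c (t + pi *+ 2) = c t by rewrite /c /n pp pq.
have pd t : d (t + pi *+ 2) = d t by rewrite /d pc pq.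
(* (a + ib)(c + id) / m, where c + id is the principal square root of p + iq *)
exists (fun t => (a t * c t - b t * d t) / m t),
  (fun t => (a t * d t + b t * c t) / m t); split.
- split=> t; apply: cvgM.
  + apply: cvgB; apply: cvgM; by [apply: ca|apply: cb|apply: cc|apply: cd].
  + by apply: cvgV; [rewrite gt_eqF|exact: cm].
  + apply: cvgD; apply: cvgM; by [apply: ca|apply: cb|apply: cc|apply: cd].
  + by apply: cvgV; [rewrite gt_eqF|exact: cm].
- by split=> t; rewrite pc pd pm pa pb.
move=> t.
have [abx aby] := ab t.
have c2 : c t ^+ 2 = (n t + p t) / 2.
  by rewrite sqr_sqrtr// divr_ge0// addr_ge0// ltW// dot.
have n2 : n t ^+ 2 = p t ^+ 2 + q t ^+ 2 by rewrite sqr_sqrtr// addr_ge0// sqr_ge0.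
have m2 : m t ^+ 2 = x t ^+ 2 + y t ^+ 2 by rewrite sqr_sqrtr// addr_ge0// sqr_ge0.
have cn0 : c t != 0 by rewrite gt_eqF.
have mn0 : m t != 0 by rewrite gt_eqF.
have cd2 : 2 * c t * d t = q t by rewrite /d; field.
have c2d2 : c t ^+ 2 - d t ^+ 2 = p t.
  have c4 : 4 * c t ^+ 2 != 0 by rewrite mulf_neq0// expf_neq0.
  have np0 : n t + p t != 0.
    by apply/eqP => h; move: c2; rewrite h mul0r => /eqP; rewrite expf_eq0/= (negPf cn0).
  have -> : d t ^+ 2 = q t ^+ 2 / (4 * c t ^+ 2) by rewrite /d; field.
  rewrite c2; have -> : q t ^+ 2 = n t ^+ 2 - p t ^+ 2 by rewrite n2; ring.
  by field.
have e1 : p t * x t - q t * y t = x' t * m t ^+ 2 by rewrite m2 /p /q; ring.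
have e2 : p t * y t + q t * x t = y' t * m t ^+ 2 by rewrite m2 /p /q; ring.
split.
  transitivity (((c t ^+ 2 - d t ^+ 2) * (a t ^+ 2 - b t ^+ 2) -
                 (2 * c t * d t) * (2 * a t * b t)) / m t ^+ 2).
    by field.
  by rewrite cd2 c2d2 abx aby e1; field.
transitivity (((c t ^+ 2 - d t ^+ 2) * (2 * a t * b t) +
               (2 * c t * d t) * (a t ^+ 2 - b t ^+ 2)) / m t ^+ 2).
  by field.
by rewrite cd2 c2d2 abx aby e2; field.
Qed.

Lemma has_sqrt_cst (a b : R) : has_sqrt (fun=> a ^+ 2 - b ^+ 2) (fun=> 2 * a * b).
Proof. by exists (fun=> a), (fun=> b); split=> //; split; exact: cst_continuous. Qed.

(** Such a loop makes an acute angle with one of the constants 1, -1, 2i, -2i,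
    which are the squares of 1, i, 1 + i, 1 - i. *)
Lemma has_sqrt_halfplane x y :
  continuous x -> continuous y -> periodic x (pi *+ 2) -> periodic y (pi *+ 2) ->
  (forall t, 0 < x t) \/ (forall t, x t < 0) \/
    (forall t, 0 < y t) \/ (forall t, y t < 0) ->
  has_sqrt x y.
Proof.
move=> cx cy px py s.
have cst (k : R) : continuous (fun _ : R => k) by exact: cst_continuous.
have {s} [a [b ab]] : exists a b : R,
    forall t, 0 < (a ^+ 2 - b ^+ 2) * x t + (2 * a * b) * y t.
  case: s => [s|[s|[s|s]]].
  - by exists 1, 0 => t; have := s t; lra.
  - by exists 0, 1 => t; have := s t; lra.
  - by exists 1, 1 => t; have := s t; lra.
  - by exists 1, (-1) => t; have := s t; lra.
by apply: has_sqrt_stable ab (has_sqrt_cst a b) => //.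
Qed.

(** The imaginary part b of a square root vanishes only where x + iy is on the
    closed positive real axis, so it has constant sign on the open period after
    the crossing s.  The real part a does not vanish at s, so by periodicity it
    has the same sign at both ends of that period, and so would y = 2ab. *)
Lemma no_sqrt_single_crossing x y (s : R) :
  periodic y (pi *+ 2) -> 0 < x s ->
  (forall t, s < t < s + pi *+ 2 -> y t = 0 -> x t < 0) ->
  (\forall h \near 0^'+, y (s + h) * y (s - h) < 0) ->
  ~ has_sqrt x y.
Proof.
move=> py xs0 off sgn [a [b [[ca cb] [pa pb] ab]]].
have pi0 : 0 < (pi : R) := pi_gt0 _.
have bn0 t : s < t < s + pi *+ 2 -> b t != 0.
  move=> st; apply/eqP => bt0; have [abx aby] := ab t.
  have yt0 : y t = 0 by rewrite -aby bt0 mulr0.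
  by have := off _ st yt0; rewrite -abx bt0 expr0n subr0 ltNge sqr_ge0.
have bb t t' : s < t -> t <= t' -> t' < s + pi *+ 2 -> 0 < b t * b t'.
  move=> st tt' t's; rewrite ltNge; apply/negP => bb0.
  have [||c ctt' bc0] := @IVT _ b t t' 0 tt'.
  - exact: continuous_subspaceT.
  - rewrite ge_min le_max.
    have /bn0 : s < t < s + pi *+ 2 by lra.
    have /bn0 : s < t' < s + pi *+ 2 by lra.
    by case: (ltgtP (b t) 0) => ?; case: (ltgtP (b t') 0) => ?; rewrite ?orbT//=; nra.
  have /eqP := bc0; apply/negP/bn0; move: ctt'; rewrite in_itv/=; lra.
have as0 : 0 < a s ^+ 2 by have [abx _] := ab s; have := sqr_ge0 (b s); lra.
have aa : \forall h \near 0^'+, 0 < a (s + h) * a (s - h).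
  have : a (s + h) * a (s - h) @[h --> 0^'+] --> a s ^+ 2.
    rewrite expr2; apply: cvgM.
    - apply: cvg_at_right_filter; rewrite -[X in a X](addr0 s);
      apply: (@continuous_comp _ _ _ (fun h : R => s + h : R)); last exact: ca.
      by apply: cvgD; [exact: cvg_cst|exact: cvg_id].
    - apply: cvg_at_right_filter; rewrite -[X in a X](subr0 s);
      apply: (@continuous_comp _ _ _ (fun h : R => s - h : R)); last exact: ca.
      by apply: cvgB; [exact: cvg_cst|exact: cvg_id].
  by move=> /cvgr_gt; apply.
have : \forall h \near (0:R)^'+, False.
  near=> h.
  have h0 : 0 < h by near: h; exact: nbhs_right_gt.
  have hpi : h < pi by near: h; exact: nbhs_right_lt.
  have : y (s + h) * y (s - h) < 0 by near: h.
  have : 0 < a (s + h) * a (s - h) by near: h.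
  have [_ <-] := ab (s + h); have [_ <-] := ab (s - h).
  have : 0 < b (s + h) * b (s - h + pi *+ 2) by apply: bb; lra.
  by rewrite pb; nra.
by move=> /filter_ex[].
Unshelve. all: by end_near. Qed.

End square_roots.

(** * Loops and the components of their complements *)

Lemma continuous_pair (X Y Z : topologicalType) (f : X -> Y) (g : X -> Z) (x : X) :
  {for x, continuous f} -> {for x, continuous g} ->
  {for x, continuous (fun y => (f y, g y))}.
Proof.
by move=> cf cg; exact: (cvg_pair (FG := nbhs_filter _) (FH := nbhs_filter _) cf cg).
Qed.

Lemma continuous_coord (R : realType) m n (X : topologicalType)
    (f : X -> 'M[R]_(m, n)) i j x :
  {for x, continuous f} -> {for x, continuous (fun t => f t i j)}.
Proof.
move=> cf; apply: (@continuous_comp _ _ _ f (fun u : 'M[R]_(m, n) => u i j)) => //.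
exact: coord_continuous.
Qed.

Lemma continuous_mx (R : realType) m n (X : topologicalType)
    (f : X -> 'M[R]_(m, n)) x :
  (forall i j, {for x, continuous (fun t => f t i j)}) -> {for x, continuous f}.
Proof.
move=> cf; apply/cvgrPdist_le => /= e e0; near=> t.
rewrite /Num.Def.normr/= mx_normrE (bigmax_le _ (ltW e0))//= => i _; rewrite !mxE.
move: i; near: t; apply: filter_forall => /= i.
exact: ((cvgrPdist_le _ _).1 (cf i.1 i.2)).
Unshelve. all: by end_near. Qed.

Section loops.
Context {R : realType}.
Local Notation plane := 'rV[R]_2.

Lemma rV2P (u v : plane) :
  u ord0 ord0 = v ord0 ord0 -> u ord0 ord_max = v ord0 ord_max -> u = v.
Proof.
move=> e0 e1; apply/rowP => i.
have [->|->] : i = ord0 \/ i = ord_max; [|exact: e0|exact: e1].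
by case: i => -[|[|//]] ?; [left|right]; apply: val_inj.
Qed.

(** One representative s serves all functions of period T at once. *)
Lemma periodic_reduce (T : R) (t : R) : 0 < T ->
  exists2 s, 0 <= s <= T &
    forall (U : zmodType) (f : R -> U), periodic f T -> f t = f s.
Proof.
move=> T0; pose k := Num.floor (t / T).
have [k1 k2] : k%:~R <= t / T /\ t / T < k%:~R + 1.
  by have /andP[] := floor_itv (t / T); rewrite intrD1.
exists (t - k%:~R * T).
  move: k1 k2; rewrite ler_pdivlMr// ltr_pdivrMr// mulrDl mul1r; lra.
move=> U f pf; case: k {k1 k2} => n.
  by rewrite -[in LHS](subrK (n%:~R * T) t) mulrzl periodicn.
by rewrite NegzE mulrNz mulNr opprK mulrzl periodicn.
Qed.

Definition even_winding (g : R -> plane) :=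
  has_sqrt (fun t => g t ord0 ord0) (fun t => g t ord0 ord_max).

(** The scalar product of H i t with H i0 t is positive at i = i0, hence, by
    compactness of a period, positive for all t once i is close to i0. *)
Lemma even_winding_near (I : topologicalType) (H : I -> R -> plane) (i0 : I) :
  continuous (fun p : I * R => H p.1 p.2) ->
  (forall i, periodic (H i) (pi *+ 2)) -> (forall t, H i0 t <> 0) ->
  \forall i \near i0,
    (forall t, H i t <> 0) /\ (even_winding (H i) <-> even_winding (H i0)).
Proof.
move=> cH pH H0.
pose dot i t : R := H i0 t ord0 ord0 * H i t ord0 ord0 +
                    H i0 t ord0 ord_max * H i t ord0 ord_max.
have cHi i j : continuous (fun t => H i t ord0 j).
  move=> t; apply: continuous_coord.
  apply: (@continuous_comp _ _ _ (fun t => (i, t)) (fun p : I * R => H p.1 p.2)).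
    by apply: continuous_pair; [exact: cst_continuous|exact: cvg_id].
  exact: cH.
have pHi i j : periodic (fun t => H i t ord0 j) (pi *+ 2) by move=> t /=; rewrite pH.
suff : \forall i \near i0, forall t, 0 < dot i t.
  move=> dotP; near=> i; have doti : forall t, 0 < dot i t by near: i.
  split; first by move=> t H0t; have := doti t; rewrite /dot H0t !mxE !mulr0 addr0 ltxx.
  split; apply: has_sqrt_stable;
    by [exact: cHi|exact: pHi|exact: doti|
        move=> t; have := doti t; rewrite /dot; lra].
have := @segment_compact R 0 (pi *+ 2); rewrite compact_near_coveringP.
move=> /(_ _ (nbhs i0) (fun i t => 0 < dot i t)) cov.
have : \forall i \near i0, `[0, pi *+ 2] `<=` (fun t => 0 < dot i t).
  apply: cov => t _.
  have : dot p.2 p.1 @[p --> (t, i0)] --> dot i0 t.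
    have c1 j : {for (t, i0), continuous (fun p : R * I => H i0 p.1 ord0 j)}.
      apply: (@continuous_comp _ _ _ (fun p : R * I => p.1) (fun t => H i0 t ord0 j)).
        exact: cvg_fst.
      exact: cHi.
    have c2 j : {for (t, i0), continuous (fun p : R * I => H p.2 p.1 ord0 j)}.
      apply: (@continuous_coord _ _ _ _ (fun p : R * I => H p.2 p.1)).
      apply: (@continuous_comp _ _ _ (fun p : R * I => (p.2, p.1))
                                     (fun p : I * R => H p.1 p.2)).
        by apply: continuous_pair; [exact: cvg_snd|exact: cvg_fst].
      exact: cH.
    by apply: cvgD; apply: cvgM; by [apply: c1|apply: c2].
  move=> /cvgr_gt /(_ 0); apply.
  rewrite /dot -!expr2 lt_neqAle addr_ge0 ?sqr_ge0// andbT eq_sym paddr_eq0 ?sqr_ge0//.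
  rewrite !sqrf_eq0; apply/negP => /andP[/eqP x0 /eqP y0].
  by apply: (H0 t); apply: rV2P; rewrite mxE.
apply: filterS => i it t.
have [|s s02 e] := @periodic_reduce (pi *+ 2) t.
  by rewrite pmulrn_lgt0// pi_gt0.
rewrite (e _ (dot i)); last by move=> u; rewrite /dot !pH.
by apply: it; rewrite /= in_itv.
Unshelve. all: by end_near. Qed.

Lemma compact_range_loop (g : R -> plane) :
  continuous g -> periodic g (pi *+ 2) -> compact (range g).
Proof.
move=> cg pg; have -> : range g = g @` `[0, pi *+ 2].
  apply/seteqP; split=> _ [t _ <-]; last by exists t.
  have [|s s02 e] := @periodic_reduce (pi *+ 2) t.
    by rewrite pmulrn_lgt0// pi_gt0.
  rewrite (e _ _ pg).
  by exists s => //; rewrite /= in_itv.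
apply: continuous_compact; last exact: segment_compact.
exact: continuous_subspaceT.
Qed.

Lemma closed_range_loop (g : R -> plane) :
  continuous g -> periodic g (pi *+ 2) -> closed (range g).
Proof.
move=> cg pg; apply: compact_closed; last exact: compact_range_loop.
exact: norm_hausdorff.
Qed.

(** The parity is locally constant off the loop, hence constant on the component
    of z.  That component contains points far from the loop, about which the loop
    stays in a half-plane. *)
Lemma even_winding_unbounded (g : R -> plane) (z : plane) :
  continuous g -> periodic g (pi *+ 2) -> ~ range g z ->
  ~ bounded_set (connected_component (~` range g) z) ->
  even_winding (fun t => g t - z).
Proof.
move=> cg pg gz; set A := connected_component _ _ => unb.
have crange w : ~ range g w -> forall t, g t - w <> 0.
  by move=> gw t /eqP; rewrite subr_eq0 => /eqP gt; apply: gw; exists t.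
have cdiff : continuous (fun p : plane * R => g p.2 - p.1).
  move=> p; apply: cvgB; last exact: cvg_fst.
  by apply: (@continuous_comp _ _ _ snd g); [exact: cvg_snd|exact: cg].
have pdiff (w : plane) : periodic (fun t => g t - w) (pi *+ 2) by move=> t; rewrite pg.
have winding_near w : ~ range g w -> \forall w' \near w,
    ~ range g w' /\ (even_winding (fun t => g t - w') <-> even_winding (fun t => g t - w)).
  move=> gw; have := crange w gw.
  move=> /(@even_winding_near _ (fun (w : plane) t => g t - w) w cdiff pdiff).
  apply: filterS => w' [w'0 nw'].
  by split=> // -[t _ gt]; apply: (w'0 t); rewrite gt subrr.
have [w Aw nw] : exists2 w, A w & even_winding (fun t => g t - w).
  have [M [_ /(_ (M + 1))]] := compact_bounded (compact_range_loop cg pg).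
  rewrite ltrDl ltr01 => /(_ isT) gM.
  have [w [Aw wM]] : exists w, A w /\ M + 1 < `|w|.
    apply: contrapT => noW; apply: unb; exists (M + 1); split; first exact: num_real.
    move=> x Mx y Ay /=; rewrite leNgt; apply/negP => xy.
    by apply: noW; exists y; split=> //; exact: lt_trans xy.
  exists w => //; have gj t j : `|g t ord0 j| <= M + 1.
    apply: le_trans (gM (g t) _); last by exists t.
    rewrite /Num.Def.normr/= mx_normrE; exact: (le_bigmax _ _ (ord0, j)).
  have cgj j : continuous (fun t => (g t - w) ord0 j).
    move=> t; apply: (@continuous_coord _ _ _ _ (fun t => g t - w)).
    by apply: cvgB; [exact: cg|exact: cvg_cst].
  have pgj j : periodic (fun t => (g t - w) ord0 j) (pi *+ 2).
    by move=> t /=; rewrite pdiff.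
  have wj : M + 1 < `|w ord0 ord0| \/ M + 1 < `|w ord0 ord_max|.
    apply: contrapT => /not_orP[/negP + /negP]; rewrite -!leNgt => w0 w1.
    move: wM; rewrite ltNge => /negP; apply.
    rewrite /Num.Def.normr/= mx_normrE; apply: bigmax_le.
      exact: le_trans w0.
    move=> [i j] _ /=; rewrite (ord1 i).
    have [->|->] : j = ord0 \/ j = ord_max; [|exact: w0|exact: w1].
    by case: j => -[|[|//]] ?; [left|right]; apply: val_inj.
  have big (x y : R) : `|x| <= M + 1 -> M + 1 < y -> x - y < 0.
    by rewrite ler_norml; lra.
  have small (x y : R) : `|x| <= M + 1 -> y < - (M + 1) -> 0 < x - y.
    by rewrite ler_norml; lra.
  apply: has_sqrt_halfplane => //.
  case: wj; rewrite lter_normr => /orP[] wM1.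
  - by right; left => t; rewrite !mxE big.
  - by left => t; rewrite !mxE small//; lra.
  - by right; right; right => t; rewrite !mxE big.
  - by right; right; left => t; rewrite !mxE small//; lra.
(* P and the complement of Q cut out the same part of A, so it is clopen in A. *)
pose P w := ~ range g w /\ even_winding (fun t => g t - w).
pose Q w := ~ range g w /\ ~ even_winding (fun t => g t - w).
have AC : A `<=` ~` range g by exact: connected_component_sub.
have oP : open P.
  rewrite openE => x [Cx Px]; apply: filterS (winding_near x Cx) => y [Cy xy].
  by split=> //; exact/xy.
have oQ : open Q.
  rewrite openE => x [Cx Px]; apply: filterS (winding_near x Cx) => y [Cy xy].
  by split=> //; move/xy.
suff : A `&` P = A.
  by move=> AP; have : A z; [exact: connected_component_refl|rewrite -AP => -[_ []]].
apply: (@component_connected _ (~` range g) z).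
- by exists w; split=> //; split=> //; exact: AC.
- by exists P.
- exists (~` Q); first exact: open_closedC.
  apply/seteqP; split=> x [Ax].
    by move=> [_ Px]; split=> // -[].
  move=> Qx; split=> //; split; first exact: AC.
  by apply: contrapT => Px; apply: Qx; split=> //; exact: AC.
Unshelve. all: by end_near. Qed.

Lemma segment_component (C : set plane) (x y : plane) :
  (forall r, 0 <= r <= 1 -> ~ C (x + r *: (y - x))) ->
  connected_component (~` C) x y.
Proof.
move=> xyC; exists ((fun r => x + r *: (y - x)) @` `[0, 1]); last first.
  exists 1; first by rewrite /= in_itv/= ler01 lexx.
  by rewrite scale1r addrC subrK.
split.
- exists 0; first by rewrite /= in_itv/= ler01 lexx.
  by rewrite scale0r addr0.
- by move=> _ [r r01 <-]; apply: xyC; move: r01; rewrite /= in_itv.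
- apply: connected_continuous_connected; first exact: segment_connected.
  apply: continuous_subspaceT => r; apply: cvgD; first exact: cvg_cst.
  by apply: cvgZr_tmp; exact: cvg_id.
Qed.

(** Local connectedness of the plane: a ball around w that misses C and meets the
    component can be joined to it by segments. *)
Lemma component_nbhs (C : set plane) (z w : plane) : closed C -> ~ C w ->
  closure (connected_component (~` C) z) w ->
  nbhs w (connected_component (~` C) z).
Proof.
move=> clC Cw Aw.
have : nbhs w (~` C) by exact: (closed_openC clC).
move=> /nbhs_ballP[e /= e0 eC].
have [y [Ay wy]] := Aw _ (nbhsx_ballx w e e0).
apply/nbhs_ballP; exists e => //= x wx.
apply: connected_component_trans Ay _; apply: segment_component => r /andP[r0 r1].
apply: eC; move: wx wy; rewrite -!ball_normE /= => wx wy.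
have -> : w - (y + r *: (x - y)) = (1 - r) *: (w - y) + r *: (w - x).
  by apply/rowP => i; rewrite !mxE; ring.
apply: le_lt_trans (ler_normD _ _) _; rewrite !normrZ ger0_norm ?subr_ge0// (ger0_norm r0).
have [->|rn0] := eqVneq r 0; first lra.
have : 0 < r by rewrite lt_neqAle eq_sym rn0.
by nra.
Qed.

(** The component A of z in the complement of C1 cannot meet C2, for a point of C2
    in A would be inside C1; so A lies in the component of z in the complement of
    C2, and by symmetry the two components agree.  A boundary point of A would be
    in both C1 and C2, which are disjoint.  So A is clopen and bounded in the
    plane, which is absurd. *)
Lemma mutually_outside_insides (C1 C2 : set plane) (z : plane) :
  closed C1 -> closed C2 -> C1 `<=` outside C2 -> C2 `<=` outside C1 ->
  inside C1 z -> ~ inside C2 z.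
Proof.
move=> cl1 cl2 C12 C21 [C1z b1] [C2z b2].
have sub C C' : C `<=` outside C' -> ~ C' z ->
    bounded_set (connected_component (~` C') z) -> ~ C z ->
    connected_component (~` C') z `<=` connected_component (~` C) z.
  move=> CC' C'z bC' Cz; apply: connected_component_max.
  - exact: connected_component_refl.
  - move=> y Ay Cy; have [_] := CC' y Cy.
    by rewrite -(same_connected_component Ay).
  - exact: component_connected.
set A := connected_component (~` C1) z.
have A2 : A = connected_component (~` C2) z by apply/seteqP; split; exact: sub.
have Az : A z by exact: connected_component_refl.
have clo w : closure A w -> nbhs w A.
  move=> Aw; have [C1w|C1w] := pselect (C1 w); last exact: component_nbhs.
  have [C2w _] := C12 _ C1w.
  by rewrite A2 in Aw *; exact: component_nbhs.
have oA : open A by rewrite openE => w Aw; apply: clo; exact: subset_closure.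
have cA : closed A by move=> w /clo /nbhs_singleton.
have AT w : A w.
  pose s r := z + r *: (w - z).
  have cs : continuous s.
    by move=> r; apply: cvgD; [exact: cvg_cst|apply: cvgZr_tmp; exact: cvg_id].
  have : `[0, 1]%classic `&` s @^-1` A = `[0, 1]%classic.
    apply: (@segment_connected R 0 1).
    - by exists 0; split; rewrite /= ?in_itv/= ?lexx ?ler01// /s scale0r addr0.
    - by exists (s @^-1` A) => //; apply: open_comp oA => r _; exact: cs.
    - by exists (s @^-1` A) => //; apply: closed_comp cA => r _; exact: cs.
  move=> /seteqP[_ /(_ 1)]; rewrite /= in_itv/= lexx ler01 => /(_ isT)[_].
  by rewrite /s scale1r addrC subrK.
have [M [_ /(_ (M + 1))]] := b1.
rewrite ltrDl ltr01 => /(_ isT) /(_ (const_mx (`|M| + 2)) (AT _)) /=.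
rewrite leNgt => /negP; apply.
apply: lt_le_trans (_ : `|M| + 2 <= _); first by have := ler_norm M; lra.
rewrite /Num.Def.normr/= mx_normrE.
apply: le_trans (le_bigmax _ _ (ord0, ord0)) => /=.
by rewrite mxE ler_norm.
Qed.

End loops.

(** * A point of odd winding for an embedded regular loop *)

Section embedded_loops.
Context {R : realType}.
Local Notation plane := 'rV[R]_2.

Lemma derive_neq0_crossing (y : R -> R) (s : R) :
  derivable y s 1 -> 'D_1 y s != 0 -> exists2 e : R, 0 < e &
    forall h, 0 < h < e -> (y (s + h) - y s) * (y (s - h) - y s) < 0.
Proof.
move=> dy; set c := 'D_1 y s => c0.
have : h^-1 *: (y (h *: 1 + s) - y s) @[h --> 0^'] --> c by exact: dy.
have c20 : 0 < c * c by rewrite -expr2 exprn_even_gt0.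
move=> qc; have {qc} : (h^-1 *: (y (h *: 1 + s) - y s)) * c @[h --> 0^'] --> c * c.
  by apply: cvgM => //; exact: cvg_cst.
move=> /cvgr_gt /(_ _ c20) [e /= e0 He]; exists e => // h /andP[h0 he].
have := He h; have := He (- h); rewrite /ball_/= !sub0r opprK normrN gtr0_norm//.
rewrite oppr_eq0 gt_eqF// /GRing.scale/= !mulr1 => /(_ he isT) + /(_ he isT).
rewrite invrN !(addrC _ s) => n p.
have hV : 0 < h^-1 by rewrite invr_gt0.
have {n} n : (y (s - h) - y s) * c < 0 by nra.
have {p} p : 0 < (y (s + h) - y s) * c by nra.
by nra.
Qed.

(** At the rightmost point g s the velocity is vertical and nonzero, so the height
    of g crosses that of g s in a simple way.  By injectivity the loop keeps a
    distance e from g s away from the parameter s; hence the horizontal ray that starts at distance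
    e / 2 to the left of g s meets the loop only at g s. *)
Lemma embedded_loop_odd_winding (g : R -> plane) :
  continuous g -> periodic g (pi *+ 2) ->
  (forall s t, s < t < s + pi *+ 2 -> g s <> g t) ->
  (forall t, derivable g t 1 /\ 'D_1 g t <> 0) ->
  exists z, (forall t, g t - z <> 0) /\ ~ even_winding (fun t => g t - z).
Proof.
move=> cg pg injg dg.
have pi0 : 0 < (pi : R) := pi_gt0 _.
have pi20 : 0 < (pi : R) *+ 2 by rewrite pmulrn_lgt0.
have cgj j : continuous (fun t => g t ord0 j).
  by move=> t; apply: (@continuous_coord _ _ _ _ g); exact: cg.
have [s _ smax] := EVT_max (ltW pi20) (continuous_subspaceT (cgj ord0)).
have {}smax t : g t ord0 ord0 <= g s ord0 ord0.
  have [r r2 e] := periodic_reduce t pi20.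
  by rewrite (e _ _ pg); apply: smax; rewrite in_itv.
have dgj t j : derivable (fun t => g t ord0 j) t 1.
  have [dgt _] := dg t; exact: (derivable_mxP g t 1).1.
have x's : 'D_1 (fun t => g t ord0 ord0) s = 0.
  have [] := @derive1_at_max R (fun t => g t ord0 ord0) (s - 1) (s + 1) s.
  - by lra.
  - by move=> t _; exact: dgj.
  - by rewrite in_itv/=; lra.
  - by move=> t _; exact: smax.
  - by [].
have y's : 'D_1 (fun t => g t ord0 ord_max) s != 0.
  apply/eqP => y's; have [dgs] := dg s; apply.
  by rewrite derive_mx//; apply: rV2P; rewrite !mxE.
have [d d0 cross] := derive_neq0_crossing (dgj s ord_max) y's.
(* On the period after s, the height differs from that of g s within d of the
   two ends; the middle part is a nonempty compact set because d' < pi. *)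
pose d' := Num.min (d / 2) (pi / 2).
have [d'0 d'd d'pi] : [/\ 0 < d', d' < d & d' < pi].
  rewrite /d'; split; first by rewrite lt_min; apply/andP; split; lra.
    by rewrite gt_min; apply/orP; left; lra.
  by rewrite gt_min; apply/orP; right; lra.
have yn0 h : 0 < h < d -> g (s + h) ord0 ord_max <> g s ord0 ord_max /\
                          g (s - h) ord0 ord_max <> g s ord0 ord_max.
  by move=> /cross p; split=> e; move: p; rewrite e subrr ?mul0r ?mulr0 ltxx.
have cn : continuous (fun t => `|g t - g s|).
  move=> t; apply: cvg_norm; apply: cvgB; [exact: cg|exact: cvg_cst].
have sd : s + d' <= s + pi *+ 2 - d' by lra.
have [m m_in mmin] := EVT_min sd (continuous_subspaceT cn).
pose e := `|g m - g s|.
have e0 : 0 < e.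
  rewrite normr_gt0 subr_eq0; apply/eqP => /esym; apply: injg.
  by move: m_in; rewrite in_itv/=; lra.
(* slightly to the left of the rightmost point g s *)
pose z : plane :=
  \row_(j < 2) (if j == ord0 then g s ord0 ord0 - e / 2 else g s ord0 ord_max).
have z0 : z ord0 ord0 = g s ord0 ord0 - e / 2 by rewrite mxE.
have z1 : z ord0 ord_max = g s ord0 ord_max by rewrite mxE.
have off t : s < t < s + pi *+ 2 -> g t ord0 ord_max = g s ord0 ord_max ->
    g t ord0 ord0 < g s ord0 ord0 - e / 2.
  move=> st yt; rewrite ltNge; apply/negP => xt.
  have [t1|t1] := ltrP t (s + d').
    have [|+ _] := yn0 (t - s); first by lra.
    by rewrite addrC subrK.
  have [t2|t2] := ltrP (s + pi *+ 2 - d') t.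
    have [|_ +] := yn0 (s + pi *+ 2 - t); first by lra.
    rewrite -pg; apply; rewrite -yt; congr (g _ _ _); lra.
  have : e <= `|g t - g s| by apply: mmin; rewrite in_itv/= t1.
  rewrite {1}/Num.Def.normr/= mx_normrE; apply/negP; rewrite -ltNge.
  apply: bigmax_lt => // -[i j] _ /=; rewrite (ord1 i) !mxE.
  have [->|->] : j = ord0 \/ j = ord_max.
    by case: j => -[|[|//]] ?; [left|right]; apply: val_inj.
    by have := smax t; rewrite ltr_norml; lra.
  by rewrite yt subrr normr0.
exists z; split.
  move=> t /eqP; rewrite subr_eq0 => /eqP gtz.
  have [r /andP[r0 r2] eg] := periodic_reduce (t - s) pi20.
  have {}eg : g t = g (s + r).
    have := eg _ (fun u => g (s + u)); rewrite (addrC s) subrK; apply => u.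
    by rewrite addrA pg.
  have gsz : g s <> z by move=> /(congr1 (fun u : plane => u ord0 ord0)); rewrite z0; lra.
  have [r0'|rn0] := eqVneq r 0; first by apply: gsz; rewrite -gtz eg r0' addr0.
  have [r2'|rn2] := eqVneq r (pi *+ 2); first by apply: gsz; rewrite -gtz eg r2' pg.
  have /off : s < s + r < s + pi *+ 2.
    by rewrite ltrDl ltrD2l !lt_neqAle r0 r2 eq_sym rn0 rn2.
  by rewrite -eg gtz z0 z1 ltxx => /(_ erefl).
apply: (@no_sqrt_single_crossing _ _ _ s).
- by move=> t /=; rewrite pg.
- by rewrite !mxE eqxx; lra.
- by move=> t /off + /eqP; rewrite !mxE/= subr_eq0 => + /eqP yt => /(_ yt); lra.
near=> h; rewrite !mxE/=; apply: cross.
apply/andP; split; first by near: h; exact: nbhs_right_gt.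
by near: h; exact: nbhs_right_lt.
Unshelve. all: by end_near. Qed.

End embedded_loops.

(** * Calculus of C^k functions *)

Section smooth_calculus.
Context {R : realType} {V : normedModType R}.
Implicit Types (A : set V) (f g : V -> R).

(** The value of a directional derivative at a point of an open set only depends
    on the restriction to that set, which is what lets the formulas for the
    derivatives of sums, products and inverses be used pointwise below. *)
Lemma Ck_congr (W : normedModType R) k A (f g : V -> W) :
  open A -> (forall x, A x -> f x = g x) -> Ck k A f -> Ck k A g.
Proof.
move=> oA; elim: k f g => [|k IH] f g fg [cf df];
  have nfg x (Ax : A x) : {near x, f =1 g} by
    apply: filterS fg _; exact: open_nbhs_nbhs.
all: split=> //; try by move=> x Ax; rewrite /prop_for /continuous_at -fg//;
  apply: cvg_trans (cf x Ax); apply: near_eq_cvg; exact: nfg.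
move=> v; have [dfv Cfv] := df v; split=> [x Ax|].
  by apply: near_eq_derivable (dfv x Ax); exact: nfg.
by apply: IH Cfv => x Ax; apply: near_eq_derive; exact: nfg.
Qed.

Lemma CkS (W : normedModType R) k A (f : V -> W) : Ck k.+1 A f -> Ck k A f.
Proof.
elim: k f => [|k IH] f [cf df]; split=> // v.
by have [dfv Cfv] := df v; split=> //; exact: IH.
Qed.

Lemma Ck_cst (W : normedModType R) k A (w : W) : Ck k A (fun=> w).
Proof.
elim: k w => [|k IH] w; split=> //; try by move=> x _; exact: cst_continuous.
move=> v; split=> [x _|]; first exact: derivable_cst.
rewrite (_ : (fun x => 'D_v _ x) = cst 0); first exact: IH.
by apply/funext => x; exact: derive_cst.
Qed.

Lemma CkD k A f g : open A -> Ck k A f -> Ck k A g -> Ck k A (fun x => f x + g x).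
Proof.
move=> oA; elim: k f g => [|k IH] f g [cf df] [cg dg]; split=> //;
  try by move=> x Ax; apply: cvgD; [exact: cf|exact: cg].
move=> v; have [dfv Cfv] := df v; have [dgv Cgv] := dg v.
split=> [x Ax|]; first by apply: derivableD; [exact: dfv|exact: dgv].
apply: Ck_congr oA _ (IH _ _ Cfv Cgv) => x Ax.
by rewrite -deriveD//; [exact: dfv|exact: dgv].
Qed.

Lemma CkM k A f g : open A -> Ck k A f -> Ck k A g -> Ck k A (fun x => f x * g x).
Proof.
move=> oA; elim: k f g => [|k IH] f g Cf Cg; have [cf df] := Cf; have [cg dg] := Cg;
  split=> //; try by move=> x Ax; apply: cvgM; [exact: cf|exact: cg].
move=> v; have [dfv Cfv] := df v; have [dgv Cgv] := dg v.
split=> [x Ax|]; first by apply: derivableM; [exact: dfv|exact: dgv].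
have Cs := CkD oA (IH _ _ (CkS Cf) Cgv) (IH _ _ (CkS Cg) Cfv).
apply: Ck_congr oA _ Cs => x Ax.
by apply: esym; exact: (deriveM (dfv x Ax) (dgv x Ax)).
Qed.

Lemma CkN k A f : open A -> Ck k A f -> Ck k A (fun x => - f x).
Proof.
move=> oA Cf; apply: Ck_congr oA _ (CkM oA (Ck_cst k A (-1 : R)) Cf) => x _.
exact: mulN1r.
Qed.

Lemma CkX k A f n : open A -> Ck k A f -> Ck k A (fun x => f x ^+ n).
Proof.
move=> oA Cf; elim: n => [|n IH].
  by apply: Ck_congr oA _ (Ck_cst k A (1 : R)) => x _; rewrite expr0.
by apply: Ck_congr oA _ (CkM oA Cf IH) => x _; rewrite exprS.
Qed.

(** The derivative of 1/f is - f' / f^2, in which 1/f occurs at the lower order. *)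
Lemma CkV k A f : open A -> (forall x, A x -> f x != 0) ->
  Ck k A f -> Ck k A (fun x => (f x)^-1).
Proof.
move=> oA f0; elim: k f f0 => [|k IH] f f0 Cf; have [cf df] := Cf;
  split=> //; try by move=> x Ax; apply: cvgV; [exact: f0|exact: cf].
move=> v; have [dfv Cfv] := df v.
split=> [x Ax|]; first by apply: derivableV; [exact: f0|exact: dfv].
have CV := IH f f0 (CkS Cf).
have Cs := CkM oA (Ck_cst k A (-1 : R)) (CkM oA (CkM oA CV CV) Cfv).
apply: Ck_congr oA _ Cs => x Ax.
rewrite deriveV; [|exact: f0|exact: dfv].
by rewrite /GRing.scale/= mulN1r mulNr expr2 invfM.
Qed.

Lemma Ck_mx m n k A (f : V -> 'M[R]_(m, n)) : open A ->
  (forall i j, Ck k A (fun x => f x i j)) -> Ck k A f.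
Proof.
move=> oA; elim: k f => [|k IH] f Cf; split=> //;
  try by move=> x Ax; apply: continuous_mx => i j; have [+ _] := Cf i j; apply.
move=> v; have df x : A x -> derivable f x v.
  by move=> Ax; apply/derivable_mxP => i j; have [_ /(_ v)[+ _]] := Cf i j; apply.
split=> //; apply: IH => i j; have [_ /(_ v)[_ Cij]] := Cf i j.
by apply: Ck_congr oA _ Cij => x Ax; rewrite derive_mx ?mxE//; exact: df.
Qed.

End smooth_calculus.

Lemma is_derive_coord (R : realType) m n (i : 'I_m) (j : 'I_n) (x v : 'M[R]_(m, n)) :
  is_derive x v (fun u : 'M[R]_(m, n) => u i j) (v i j).
Proof.
have [d e] := is_derive_id x v; split; first exact: (derivable_mxP id x v).1.
by move: e; rewrite derive_mx// => /(congr1 (fun u : 'M[R]_(m, n) => u i j)); rewrite mxE.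
Qed.

Lemma Ck_coord (R : realType) m n k (A : set 'M[R]_(m, n)) i j :
  Ck k A (fun u : 'M[R]_(m, n) => u i j).
Proof.
case: k => [|k]; split=> //; try by move=> x _; exact: coord_continuous.
move=> v; split=> [x _|]; first by have [] := is_derive_coord i j x v.
rewrite (_ : (fun x => 'D_v _ x) = cst (v i j)); first exact: Ck_cst.
by apply/funext => x; have [] := is_derive_coord i j x v.
Qed.

Lemma is_derive_inv (R : realType) (V : normedModType R) (f : V -> R) (x v : V) (df : R) :
  f x != 0 -> is_derive x v f df ->
  is_derive x v (fun y => (f y)^-1) (- df / f x ^+ 2).
Proof.
move=> f0 [dfx dfE]; split; first exact: derivableV.
by rewrite deriveV// /GRing.scale/= dfE mulrC !mulNr mulrN.
Qed.

Lemma Ck_continuous (R : realType) (V W : normedModType R) k (A : set V) (f : V -> W) x :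
  Ck k A f -> A x -> {for x, continuous f}.
Proof. by case: k => [|k] [cf _]; exact: cf. Qed.

(** Leaves the nonvanishing of the denominators, and the regularity of functions
    that are not built from coordinates. *)
Ltac Ck_rational oA :=
  repeat first
    [ exact: Ck_coord | exact: Ck_cst
    | apply: (CkD oA) | apply: (CkN oA) | apply: (CkM oA) | apply: (CkX oA)
    | apply: (CkV oA) ].

(** * The round sphere *)

Section sphere.
Context {R : realType}.

Definition ix : 'I_3 := @Ordinal 3 0 isT.
Definition iy : 'I_3 := @Ordinal 3 1 isT.
Definition iz : 'I_3 := @Ordinal 3 2 isT.

Definition vec2 (a b : R) : 'rV[R]_2 := \row_(i < 2) [:: a; b]`_i.
Definition vec3 (a b c : R) : 'rV[R]_3 := \row_(i < 3) [:: a; b; c]`_i.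

Lemma vec2E a b : (vec2 a b ord0 ord0 = a) * (vec2 a b ord0 ord_max = b).
Proof. by rewrite !mxE. Qed.

Lemma vec3E a b c : (vec3 a b c ord0 ix = a) * (vec3 a b c ord0 iy = b) *
  (vec3 a b c ord0 iz = c).
Proof. by rewrite !mxE. Qed.

Lemma ord1E (i : 'I_1) : i = ord0.
Proof. by apply: val_inj; case: i => -[]. Qed.

Lemma ord3P (P : 'I_3 -> Prop) : P ix -> P iy -> P iz -> forall i, P i.
Proof.
by move=> p0 p1 p2 [[|[|[|//]]] i3];
  [have := p0|have := p1|have := p2]; congr P; apply: val_inj.
Qed.

Lemma ord2P (P : 'I_2 -> Prop) : P ord0 -> P ord_max -> forall i, P i.
Proof.
by move=> p0 p1 [[|[|//]] i3]; [have := p0|have := p1]; congr P; apply: val_inj.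
Qed.

Lemma rV3P (u v : 'rV[R]_3) : u ord0 ix = v ord0 ix -> u ord0 iy = v ord0 iy ->
  u ord0 iz = v ord0 iz -> u = v.
Proof. by move=> e0 e1 e2; apply/rowP; apply: ord3P. Qed.

Lemma Ck_vec2 (V : normedModType R) k (A : set V) (a b : V -> R) : open A ->
  Ck k A a -> Ck k A b -> Ck k A (fun x => vec2 (a x) (b x)).
Proof.
move=> oA Ca Cb; apply: Ck_mx => // i j; rewrite (ord1E i) {i}; move: j.
by apply: ord2P; [apply: Ck_congr Ca|apply: Ck_congr Cb] => // x _; rewrite vec2E.
Qed.

Lemma Ck_vec3 (V : normedModType R) k (A : set V) (a b c : V -> R) : open A ->
  Ck k A a -> Ck k A b -> Ck k A c -> Ck k A (fun x => vec3 (a x) (b x) (c x)).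
Proof.
move=> oA Ca Cb Cc; apply: Ck_mx => // i j; rewrite (ord1E i) {i}; move: j.
by apply: ord3P; [apply: Ck_congr Ca|apply: Ck_congr Cb|apply: Ck_congr Cc] => // x _;
  rewrite vec3E.
Qed.

Lemma is_derive_vec3 (V : normedModType R) (x v : V) (a b c : V -> R) (da db dc : R) :
  is_derive x v a da -> is_derive x v b db -> is_derive x v c dc ->
  is_derive x v (fun x => vec3 (a x) (b x) (c x)) (vec3 da db dc).
Proof.
move=> [ea <-] [eb <-] [ec <-].
have [E0 E1 E2] : [/\ (fun x => vec3 (a x) (b x) (c x) ord0 ix) = a,
                       (fun x => vec3 (a x) (b x) (c x) ord0 iy) = b &
                       (fun x => vec3 (a x) (b x) (c x) ord0 iz) = c].
  by split; apply/funext => z; rewrite vec3E.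
have d : derivable (fun x => vec3 (a x) (b x) (c x)) x v.
  apply/derivable_mxP => i j; rewrite (ord1E i) {i}; move: j.
  by apply: (ord3P (P := fun j =>
      derivable (fun x => vec3 (a x) (b x) (c x) ord0 j) x v));
    [rewrite E0; exact: ea|rewrite E1; exact: eb|rewrite E2; exact: ec].
by split=> //; rewrite derive_mx//; apply: rV3P; rewrite mxE ?E0 ?E1 ?E2 vec3E.
Qed.

Definition sphere : set 'rV[R]_3 :=
  [set p | p ord0 ix ^+ 2 + p ord0 iy ^+ 2 + p ord0 iz ^+ 2 = 1].

Definition S2 := set_type sphere.
HB.instance Definition _ := Topological.on S2.

Definition S2_of (p : 'rV[R]_3) (h : sphere p) : S2 := exist _ p (mem_set h).

Definition pt (x : S2) : 'rV[R]_3 := set_val x.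

Lemma ptP (x : S2) : sphere (pt x).
Proof. exact: set_valP. Qed.

Lemma pt_inj : injective pt.
Proof. exact: val_inj. Qed.

Lemma pt_continuous : continuous pt.
Proof. exact: initial_continuous. Qed.

Lemma continuous_to_S2 (X : topologicalType) (f : X -> S2) (x : X) :
  {for x, continuous (pt \o f)} -> {for x, continuous f}.
Proof.
move=> cf U [_ [[W oW <-]] /= Wx sWU].
by apply: filterS sWU _; apply: cf; exact: open_nbhs_nbhs.
Qed.

Lemma S2_hausdorff : hausdorff_space S2.
Proof.
move=> x y xy; apply: pt_inj; apply: norm_hausdorff => A B nA nB.
have [z [Az Bz]] := xy _ _ (pt_continuous nA) (pt_continuous nB).
by exists (pt z).
Qed.

Lemma sphere_compact : compact sphere.
Proof.
apply: bounded_closed_compact.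
  exists 1; split; first exact: num_real.
  move=> M M1 p; rewrite /sphere/= => pS; rewrite /Num.Def.normr/= mx_normrE.
  apply: bigmax_le => [|[i j] _] /=; first lra.
  rewrite (ord1E i) {i}; move: j; apply: ord3P; apply: le_trans (ltW M1);
    rewrite ler_norml; nra.
pose q (p : 'rV[R]_3) := p ord0 ix ^+ 2 + p ord0 iy ^+ 2 + p ord0 iz ^+ 2.
have cq : continuous q.
  move=> p; apply: (@Ck_continuous _ _ _ 0 setT) => //.
  Ck_rational (@openT 'rV[R]_3).
have -> : sphere = q @^-1` [set 1] by [].
apply: closed_comp; last exact: closed_eq.
by move=> p _; exact: cq.
Qed.

Lemma S2_compact : compact [set: S2].
Proof.
move=> F PF _.
have FS : F (pt @^-1` sphere) by apply: filterS filterT => x _; exact: ptP.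
have [p [pS cp]] := sphere_compact (fmap_proper_filter pt PF) FS.
exists (S2_of pS); split=> // A B FA [_ [[W oW <-]] /= Wx sWB].
have FA' : F (pt @^-1` (pt @` A)) by apply: filterS FA => x Ax; exists x.
have [|q [[z Az zq]] Wq] := cp (pt @` A) W FA'; first exact: open_nbhs_nbhs.
by exists z; split=> //; apply: sWB; rewrite /= -/(pt z) zq.
Qed.

End sphere.

(** * The stereographic atlas *)

Section stereographic.
Context {R : realType}.
Implicit Types (b : bool) (u : 'rV[R]_2) (p : 'rV[R]_3).

(** The height of the pole at which the chart b is centred; projection is from the
    opposite pole. *)
Definition psign b : R := (-1) ^+ b.

Lemma psignK b : psign b * psign b = 1.
Proof. by case: b; rewrite /psign ?expr1 ?expr0 ?mulrNN mulr1. Qed.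

Lemma psign_neq0 b : psign b != 0.
Proof. by apply/eqP => s0; have /eqP := psignK b; rewrite s0 mul0r eq_sym oner_eq0. Qed.

Definition plane_den u : R := 1 + u ord0 ord0 ^+ 2 + u ord0 ord_max ^+ 2.

Lemma plane_den_gt0 u : 0 < plane_den u.
Proof.
have := sqr_ge0 (u ord0 ord0); have := sqr_ge0 (u ord0 ord_max).
by rewrite /plane_den; lra.
Qed.

Lemma plane_den_neq0 u : plane_den u != 0.
Proof. by rewrite gt_eqF// plane_den_gt0. Qed.

Definition stereo_inv b u : 'rV[R]_3 :=
  vec3 (2 * u ord0 ord0 / plane_den u) (2 * u ord0 ord_max / plane_den u)
       (psign b * (2 / plane_den u - 1)).

Lemma stereo_inv_sphere b u : sphere (stereo_inv b u).
Proof.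
rewrite /sphere/= !vec3E [(psign b * _) ^+ 2]exprMn [psign b ^+ 2]expr2 psignK mul1r.
have := plane_den_neq0 u; rewrite /plane_den => D0; by field.
Qed.

Definition stereo_pt b u : S2 := S2_of (stereo_inv_sphere b u).

Definition space_den b p : R := 1 + psign b * p ord0 iz.

Definition stereo_proj b p : 'rV[R]_2 :=
  vec2 (p ord0 ix / space_den b p) (p ord0 iy / space_den b p).

Lemma space_den_inv b u : space_den b (stereo_inv b u) = 2 / plane_den u.
Proof. by rewrite /space_den vec3E mulrA psignK mul1r addrC subrK. Qed.

Lemma stereo_invK b u : stereo_proj b (stereo_inv b u) = u.
Proof.
have D0 := plane_den_neq0 u.
by apply: rV2P; rewrite /stereo_proj vec2E space_den_inv vec3E; field.
Qed.

Lemma plane_den_proj b p : sphere p -> space_den b p != 0 ->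
  plane_den (stereo_proj b p) = 2 / space_den b p.
Proof.
rewrite /sphere/= => pS d0; rewrite /plane_den !vec2E.
have e : p ord0 ix ^+ 2 + p ord0 iy ^+ 2 = space_den b p * (2 - space_den b p).
  rewrite /space_den; transitivity (1 - (psign b * psign b) * p ord0 iz ^+ 2); last by ring.
  by rewrite psignK; lra.
transitivity (1 + (p ord0 ix ^+ 2 + p ord0 iy ^+ 2) / space_den b p ^+ 2); first by field.
by rewrite e; field.
Qed.

Lemma stereo_projK b p : sphere p -> space_den b p != 0 ->
  stereo_inv b (stereo_proj b p) = p.
Proof.
move=> pS d0; have d2 : 2 / space_den b p != 0 by rewrite mulf_neq0// invr_eq0.
apply: rV3P; rewrite /stereo_inv vec3E plane_den_proj// ?vec2E; try by field.
transitivity (psign b * (space_den b p - 1)); first by congr (_ * _); field.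
by rewrite /space_den addrC addKr mulrA psignK mul1r.
Qed.

Lemma Ck_plane_den k (A : set 'rV[R]_2) : open A -> Ck k A plane_den.
Proof. by move=> oA; Ck_rational oA. Qed.

Lemma Ck_stereo_inv b k (A : set 'rV[R]_2) : open A -> Ck k A (stereo_inv b).
Proof.
move=> oA; have CD := Ck_plane_den k oA; apply: Ck_vec3 => //; Ck_rational oA => //;
  by move=> x _; exact: plane_den_neq0.
Qed.

Lemma stereo_pt_continuous b : continuous (stereo_pt b).
Proof.
move=> u; apply: continuous_to_S2.
exact: (Ck_continuous (Ck_stereo_inv b 0 openT)).
Qed.

Lemma space_den_continuous b : continuous (fun x : S2 => space_den b (pt x)).
Proof.
move=> x; apply: (@continuous_comp _ _ _ pt (space_den b)); first exact: pt_continuous.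
apply: (@Ck_continuous _ _ _ 0 setT) => //; rewrite /space_den.
Ck_rational (@openT 'rV[R]_3).
Qed.

Lemma stereo_proj_continuous b (x : S2) : space_den b (pt x) != 0 ->
  {for x, continuous (fun x : S2 => stereo_proj b (pt x))}.
Proof.
move=> dx; have c j : {for x, continuous (fun y : S2 => pt y ord0 j)}.
  exact/continuous_coord/pt_continuous.
apply: continuous_mx => i j; rewrite (ord1E i); move: j.
have cd : {for x, continuous (fun y : S2 => (space_den b (pt y))^-1)}.
  exact: (cvgV dx (@space_den_continuous b x)).
apply: (ord2P (P := fun j => {for x, continuous (fun t => stereo_proj b (pt t) ord0 j)})).
  rewrite (_ : (fun t => _) = fun y : S2 => pt y ord0 ix * (space_den b (pt y))^-1).
    exact: (cvgM (c ix) cd).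
  by apply/funext => y; rewrite vec2E.
rewrite (_ : (fun t => _) = fun y : S2 => pt y ord0 iy * (space_den b (pt y))^-1).
  exact: (cvgM (c iy) cd).
by apply/funext => y; rewrite vec2E.
Qed.

Definition stereo_chart b : chart R (@S2 R).
Proof.
refine (@Chart R (@S2 R) [set x | space_den b (pt x) != 0] setT
  (fun x => stereo_proj b (pt x)) (stereo_pt b) _ _ _ _ _ _ _ _).
- have := @space_den_continuous b => /continuousP /(_ _ (@open_neq R 0)).
  by [].
- exact: openT.
- by [].
- by move=> u _ /=; rewrite space_den_inv mulf_neq0// invr_eq0 plane_den_neq0.
- by move=> x dx; apply: pt_inj; exact: stereo_projK (ptP x) dx.
- by move=> u _; exact: stereo_invK.
- by move=> x dx; exact: stereo_proj_continuous.
- by move=> u _; exact: stereo_pt_continuous.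
Defined.

Lemma stereo_cover (x : S2) : exists2 a, range stereo_chart a & cdom a x.
Proof.
have [d0|d0] := eqVneq (space_den false (pt x)) 0; last first.
  by exists (stereo_chart false); first by exists false.
exists (stereo_chart true); first by exists true.
by move: d0; rewrite /= /space_den /psign expr0 expr1 => d0; apply/eqP; lra.
Qed.

Lemma stereo_smooth (a b : chart R (@S2 R)) :
  range stereo_chart a -> range stereo_chart b ->
  smooth_on [set u | ccod a u /\ cdom b (cfrom a u)] (cto b \o cfrom a).
Proof.
move=> [s _ <-] [s' _ <-] k; set A := [set _ | _].
have oA : open A.
  rewrite (_ : A = stereo_pt s @^-1` cdom (stereo_chart s')).
    by apply: open_comp; [move=> u _; exact: stereo_pt_continuous|exact: chart_open_dom].
  by apply/seteqP; split=> u //= [].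
have CD := Ck_plane_den k oA.
have A0 u : A u -> space_den s' (stereo_inv s u) != 0 by move=> [].
have Cst j : Ck k A (fun u => stereo_inv s u ord0 j).
  move: j; apply: (ord3P (P := fun j => Ck k A (fun u => stereo_inv s u ord0 j))).
  - rewrite (_ : (fun u => _) = fun u => 2 * u ord0 ord0 / plane_den u).
      by Ck_rational oA => // x _; exact: plane_den_neq0.
    by apply/funext => u; rewrite vec3E.
  - rewrite (_ : (fun u => _) = fun u => 2 * u ord0 ord_max / plane_den u).
      by Ck_rational oA => // x _; exact: plane_den_neq0.
    by apply/funext => u; rewrite vec3E.
  - rewrite (_ : (fun u => _) = fun u => psign s * (2 / plane_den u - 1)).
      by Ck_rational oA => // x _; exact: plane_den_neq0.
    by apply/funext => u; rewrite vec3E.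
have Cden : Ck k A (fun u => space_den s' (stereo_inv s u)).
  by rewrite /space_den; Ck_rational oA => //.
by apply: Ck_vec2 => //; Ck_rational oA => //.
Qed.

Definition sphere_surface : closed_surface R :=
  ClosedSurface (@S2_hausdorff R) (@S2_compact R) stereo_cover stereo_smooth.

End stereographic.

(** * The pinched sphere, a diagram with two virtual branch points *)

Section pinched_sphere.
Context {R : realType}.
Implicit Types (b : bool) (u : 'rV[R]_2) (p : 'rV[R]_3).

(** Each circle at height z goes to the figure eight {(x y, y)} at the same
    height, which shrinks to a point at the poles. *)
Definition figure8 p : 'rV[R]_3 := vec3 (p ord0 ix * p ord0 iy) (p ord0 iy) (p ord0 iz).

Definition pinched_sphere (x : sphere_surface (R := R)) : 'rV[R]_3 := figure8 (pt x).

Definition figure8_stereo b u : 'rV[R]_3 :=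
  vec3 (4 * u ord0 ord0 * u ord0 ord_max / plane_den u ^+ 2)
       (2 * u ord0 ord_max / plane_den u)
       (psign b * (2 / plane_den u - 1)).

Lemma figure8_stereoE b u : figure8 (stereo_inv b u) = figure8_stereo b u.
Proof.
have D0 := plane_den_neq0 u.
by apply: rV3P; rewrite /figure8 /figure8_stereo !vec3E //; field.
Qed.

Lemma pinched_sphere_stereo b : pinched_sphere \o cfrom (stereo_chart b) = figure8_stereo b.
Proof. by apply/funext => u; exact: figure8_stereoE. Qed.

Lemma pinched_sphere_smooth : smooth_surface_map pinched_sphere.
Proof.
move=> _ [b _ <-] k; rewrite pinched_sphere_stereo.
have oA : open (ccod (stereo_chart (R := R) b)) by exact: openT.
have CD := Ck_plane_den k oA.
apply: Ck_vec3 => //; Ck_rational oA => // x _; rewrite ?expf_neq0//; exact: plane_den_neq0.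
Qed.

Definition figure8_diff b u (w : 'rV[R]_2) : 'rV[R]_3 :=
  let x := u ord0 ord0 in let y := u ord0 ord_max in
  let p := w ord0 ord0 in let q := w ord0 ord_max in
  let D := plane_den u in let dD := 2 * x * p + 2 * y * q in
  vec3 (4 * (p * y + x * q) / D ^+ 2 - 8 * x * y * dD / D ^+ 3)
       (2 * q / D - 2 * y * dD / D ^+ 2)
       (- (2 * psign b * dD / D ^+ 2)).

Lemma derive_figure8_stereo b u w : 'D_w (figure8_stereo b) u = figure8_diff b u w.
Proof.
have D0 := plane_den_neq0 u.
have c0 := is_derive_coord ord0 ord0 u w.
have c1 := is_derive_coord ord0 ord_max u w.
pose x (v : 'rV[R]_2) : R := v ord0 ord0.
pose y (v : 'rV[R]_2) : R := v ord0 ord_max.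
have cD : is_derive u w (@plane_den R) (2 * x u * x w + 2 * y u * y w).
  rewrite (_ : @plane_den R = cst 1 + x * x + y * y).
    apply: (is_derive_eq (is_deriveD (is_deriveD (is_derive_cst (1 : R) u w)
      (is_deriveM c0 c0)) (is_deriveM c1 c1))).
    by rewrite /GRing.scale/= /x /y; ring.
  by apply/funext => v; rewrite /plane_den !expr2.
have cV := is_derive_inv D0 cD.
have e0 : is_derive u w
    (fun u => 4 * u ord0 ord0 * u ord0 ord_max / plane_den u ^+ 2)
    (figure8_diff b u w ord0 ix).
  have m := is_deriveM (is_deriveM (is_derive_cst (4 : R) u w) (is_deriveM c0 c1))
                       (is_deriveM cV cV).
  rewrite (_ : (fun u => _) =
    cst 4 * (x * y) * ((fun u => (plane_den u)^-1) * (fun u => (plane_den u)^-1))).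
    apply: (is_derive_eq m); rewrite /GRing.scale/= vec3E !fctE /x /y.
    by field.
  by apply/funext => v; rewrite !fctE expr2 invfM !mulrA.
have e1 : is_derive u w (fun u => 2 * u ord0 ord_max / plane_den u)
    (figure8_diff b u w ord0 iy).
  apply: (is_derive_eq (is_deriveM (is_deriveM (is_derive_cst (2 : R) u w) c1) cV)).
  by rewrite /GRing.scale/= vec3E !fctE /x /y; field.
have e2 : is_derive u w (fun u => psign b * (2 / plane_den u - 1))
    (figure8_diff b u w ord0 iz).
  apply: (is_derive_eq (is_deriveM (is_derive_cst (psign b : R) u w)
    (is_deriveB (is_deriveM (is_derive_cst (2 : R) u w) cV) (is_derive_cst (1 : R) u w)))).
  by rewrite /GRing.scale/= vec3E !fctE /x /y; field.
have [_ ->] := is_derive_vec3 e0 e1 e2.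
by apply: rV3P; rewrite vec3E.
Qed.

(** A vanishing third component says that the direction w is orthogonal to the
    radius u; the second one then makes w horizontal, and the first one kills it
    unless u = 0. *)
Lemma pinched_sphere_immersed (x : S2) : pt x ord0 ix != 0 \/ pt x ord0 iy != 0 ->
  immersed_at pinched_sphere x.
Proof.
move=> xy0 _ [b _ <-] /= dx w; rewrite pinched_sphere_stereo derive_figure8_stereo.
set u := stereo_proj b (pt x) => dw.
have D0 : plane_den u != 0 := plane_den_neq0 u.
have w2 := congr1 (fun v : 'rV[R]_3 => v ord0 iz) dw.
have w1 := congr1 (fun v : 'rV[R]_3 => v ord0 iy) dw.
have w0 := congr1 (fun v : 'rV[R]_3 => v ord0 ix) dw.
rewrite /= /figure8_diff vec3E [RHS]mxE in w0.
rewrite /= /figure8_diff vec3E [RHS]mxE in w1.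
rewrite /= /figure8_diff vec3E [RHS]mxE in w2.
set dD := 2 * _ * _ + _ in w0 w1 w2.
have dD0 : dD = 0.
  move/eqP: w2; rewrite oppr_eq0 !mulf_eq0 invr_eq0 (negPf (psign_neq0 b)) expf_eq0/=.
  by rewrite (negPf D0) pnatr_eq0/= orbF => /eqP.
rewrite dD0 !mulr0 !mul0r !subr0 in w0 w1.
have q0 : w ord0 ord_max = 0.
  by move/eqP: w1; rewrite !mulf_eq0 invr_eq0 (negPf D0) pnatr_eq0/= orbF => /eqP.
rewrite q0 mulr0 addr0 in w0.
rewrite /dD q0 mulr0 addr0 in dD0.
have p0 : w ord0 ord0 = 0.
  move/eqP: w0; rewrite !mulf_eq0 invr_eq0 expf_eq0/= (negPf D0) pnatr_eq0/= orbF.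
  case/orP => [/eqP//|/eqP uy0].
  move/eqP: dD0; rewrite !mulf_eq0 pnatr_eq0/=.
  case/orP => /eqP // ux0.
  have := stereo_projK (ptP x) dx; rewrite -/u => ex.
  by case: xy0; rewrite -ex /stereo_inv vec3E ?ux0 ?uy0 mulr0 mul0r eqxx.
by apply: rV2P; rewrite mxE.
Qed.

(** In the stereographic coordinates (u, v) of the chart b, with
    D = 1 + u^2 + v^2, the image point (X, Y, Z) of the sphere satisfies
    1 + s Z = 2 / D where s = psign b.  Hence X / (1 + s Z)^2 = u v,
    Y / (1 + s Z) = v and (1 - s Z) / (1 + s Z) = u^2 + v^2: these coordinates
    straighten the image to (u v, v, u^2), the umbrella with u and v swapped. *)
Definition umbrella_coord b p : 'rV[R]_3 :=
  vec3 (p ord0 ix / space_den b p ^+ 2) (p ord0 iy / space_den b p)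
       ((1 - psign b * p ord0 iz) / space_den b p - p ord0 iy ^+ 2 / space_den b p ^+ 2).

(** D as a function of the new coordinates (u v, v, u^2). *)
Definition umbrella_den p : R := 1 + p ord0 iz + p ord0 iy ^+ 2.

Definition umbrella_coord_inv b p : 'rV[R]_3 :=
  vec3 (4 * p ord0 ix / umbrella_den p ^+ 2) (2 * p ord0 iy / umbrella_den p)
       (psign b * (2 / umbrella_den p - 1)).

Definition swap u : 'rV[R]_2 := vec2 (u ord0 ord_max) (u ord0 ord0).

Lemma swapK u : swap (swap u) = u.
Proof. by apply: rV2P; rewrite /swap !vec2E. Qed.

Lemma swap_diffeo : diffeomorphism [set: 'rV[R]_2] [set: 'rV[R]_2] swap swap.
Proof.
have sm : smooth_on [set: 'rV[R]_2] swap.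
  by move=> k; apply: Ck_vec2; [exact: openT|exact: Ck_coord|exact: Ck_coord].
by split; split=> //; try exact: openT; move=> u _; exact: swapK.
Qed.

Lemma open_pos (f : 'rV[R]_3 -> R) : (forall k, Ck k setT f) -> open [set p | 0 < f p].
Proof.
move=> Cf; apply: (@open_comp _ _ f (fun r => 0 < r)).
  by move=> p _; exact: (Ck_continuous (Cf 0)).
exact: open_gt.
Qed.

Lemma umbrella_den_coord b p : space_den b p != 0 ->
  umbrella_den (umbrella_coord b p) = 2 / space_den b p.
Proof.
rewrite /umbrella_den /umbrella_coord !vec3E /space_den => d0; by field.
Qed.

Lemma space_den_coord_inv b p : umbrella_den p != 0 ->
  space_den b (umbrella_coord_inv b p) = 2 / umbrella_den p.
Proof. by move=> d0; rewrite /space_den vec3E mulrA psignK mul1r addrC subrK. Qed.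

Lemma umbrella_coord_diffeo b :
  diffeomorphism [set p | 0 < space_den (R := R) b p] [set p | 0 < umbrella_den p]
    (umbrella_coord b) (umbrella_coord_inv b).
Proof.
have CD k A : open A -> Ck k A (space_den b).
  by move=> oA; rewrite /space_den; Ck_rational oA.
have CW k A : open A -> Ck k A umbrella_den.
  by move=> oA; rewrite /umbrella_den; Ck_rational oA.
have oV : open [set p | 0 < space_den (R := R) b p].
  by apply: open_pos => k; exact: CD openT.
have oV' : open [set p | 0 < umbrella_den p] by apply: open_pos => k; exact: CW openT.
split.
- by [].
- split=> p /= p0.
    by rewrite umbrella_den_coord ?gt_eqF// divr_gt0.
  by rewrite space_den_coord_inv ?gt_eqF// divr_gt0.
- split=> p /= p0; have n0 := lt0r_neq0 p0.
    apply: rV3P; rewrite [umbrella_coord_inv b (umbrella_coord b p)]/umbrella_coord_inv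
      umbrella_den_coord// !vec3E; try by field.
    transitivity (psign b * (space_den b p - 1)); first by congr (_ * _); field.
    by rewrite /space_den addrC addKr mulrA psignK mul1r.
  apply: rV3P; rewrite [umbrella_coord b (umbrella_coord_inv b p)]/umbrella_coord
    space_den_coord_inv// !vec3E; try by field.
  rewrite mulrA psignK mul1r.
  transitivity (umbrella_den p - 1 - p ord0 iy ^+ 2); first by field.
  by rewrite /umbrella_den; ring.
split=> k.
  apply: Ck_vec3 => //; Ck_rational oV => //; try exact: CD;
    by move=> p /= p0; rewrite ?expf_neq0// lt0r_neq0.
apply: Ck_vec3 => //; Ck_rational oV' => //; try exact: CW;
  by move=> p /= p0; rewrite ?expf_neq0// lt0r_neq0.
Qed.

Lemma pinched_sphere_pole (x : S2) : pt x ord0 ix = 0 -> pt x ord0 iy = 0 ->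
  whitney_branch_point pinched_sphere x.
Proof.
move=> x0 y0.
have [b zb] : exists b, pt x ord0 iz = psign b.
  have := ptP x; rewrite /sphere/= x0 y0 expr0n/= !add0r => /eqP.
  rewrite sqrf_eq1 => /orP[] /eqP ->; first by exists false.
  by exists true.
have dx : space_den b (pt x) = 2 by rewrite /space_den zb psignK.
exists (stereo_chart b); split; first by exists b.
  by rewrite /= dx.
exists setT, setT, swap, swap.
exists [set p | 0 < space_den (R := R) b p], [set p | 0 < umbrella_den p].
exists (umbrella_coord b), (umbrella_coord_inv b).
have fx : pinched_sphere x = vec3 0 0 (psign b).
  by apply: rV3P; rewrite /pinched_sphere /figure8 !vec3E ?x0 ?y0 ?mul0r.
split.
- by split; [exact: swap_diffeo|exact: umbrella_coord_diffeo].
- by [].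
- by split=> //; apply: rV2P; rewrite /swap /= !vec2E ?x0 ?y0 mul0r [RHS]mxE.
- rewrite fx; split; first by rewrite /= /space_den vec3E psignK.
  apply: rV3P; rewrite /umbrella_coord /space_den !vec3E psignK ?mul0r ?mxE//.
  by rewrite expr0n/= !mul0r subrr mul0r subr0.
move=> u _; have D0 := plane_den_neq0 u.
have -> : pinched_sphere (cfrom (stereo_chart b) u) = figure8_stereo b u.
  by rewrite -(pinched_sphere_stereo b).
have dn : space_den b (figure8_stereo b u) = 2 / plane_den u.
  by rewrite /space_den vec3E mulrA psignK mul1r addrC subrK.
split; first by rewrite /= dn divr_gt0// plane_den_gt0.
have Du : plane_den u = 1 + u ord0 ord0 ^+ 2 + u ord0 ord_max ^+ 2 by [].
rewrite /umbrella_coord dn /whitney_umbrella /swap !vec2E; apply: rV3P; rewrite !vec3E.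
- by field.
- by field.
rewrite mulrA psignK mul1r.
transitivity (plane_den u - 1 - u ord0 ord_max ^+ 2); first by field.
by rewrite Du; ring.
Qed.

Lemma pinched_sphere_double (x y : S2) : double_pair pinched_sphere x y ->
  [/\ pt x ord0 iy = 0, pt y ord0 iy = 0, pt y ord0 ix = - pt x ord0 ix,
      pt y ord0 iz = pt x ord0 iz & pt x ord0 ix != 0].
Proof.
move=> [xy fxy].
have e0 := congr1 (fun v : 'rV[R]_3 => v ord0 ix) fxy.
have e1 := congr1 (fun v : 'rV[R]_3 => v ord0 iy) fxy.
have e2 := congr1 (fun v : 'rV[R]_3 => v ord0 iz) fxy.
rewrite /= /pinched_sphere /figure8 !vec3E in e0 e1 e2.
have sx := ptP x; have sy := ptP y; rewrite /sphere/= in sx sy.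
have n0 : pt x ord0 ix <> pt y ord0 ix.
  by move=> e; apply: xy; apply: pt_inj; exact: rV3P.
have : (pt x ord0 ix - pt y ord0 ix) * (pt x ord0 ix + pt y ord0 ix) = 0.
  by rewrite -e1 -e2 in sy; nra.
move=> /eqP; rewrite mulf_eq0 subr_eq0 => /orP[/eqP//|/eqP s0].
have y0 : pt x ord0 iy = 0.
  have : (pt x ord0 ix - pt y ord0 ix) * pt x ord0 iy = 0 by rewrite mulrBl e0 -e1 subrr.
  by move=> /eqP; rewrite mulf_eq0 subr_eq0 => /orP[/eqP//|/eqP].
split=> //; [by rewrite -e1|lra|].
by apply/eqP => x0; apply: n0; lra.
Qed.

(** At (x, 0, z) and (- x, 0, z) the tangent planes are spanned by the vertical
    direction and by (x, 1, 0), (- x, 1, 0) respectively. *)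
Lemma pinched_sphere_transverse (x y : S2) : double_pair pinched_sphere x y ->
  forall w, exists v1 v2, [/\ tangent_image pinched_sphere x v1,
                              tangent_image pinched_sphere y v2 & w = v1 + v2].
Proof.
move=> /pinched_sphere_double[x1 y1 y0 y2 x0] w.
have d0 : space_den false (pt x) != 0.
  apply/eqP; rewrite /space_den /psign expr0 mul1r => z; move/eqP: x0; apply.
  have := ptP x; rewrite /sphere/= x1; nra.
have d0' : space_den false (pt y) != 0 by rewrite /space_den y2.
have [u eu] : exists u, stereo_proj false (pt x) = u by eexists.
have u1 : u ord0 ord_max = 0 by rewrite -eu vec2E x1 mul0r.
have u0 : u ord0 ord0 != 0 by rewrite -eu vec2E mulf_neq0// invr_neq0.
have yu : stereo_proj false (pt y) = vec2 (- u ord0 ord0) 0.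
  by apply: rV2P; rewrite -eu !vec2E ?y1 ?mul0r// /space_den y2 y0 mulNr.
have D0 := plane_den_neq0 u.
have Dy : plane_den (vec2 (- u ord0 ord0) 0) = plane_den u.
  by rewrite /plane_den !vec2E u1 sqrrN.
have tx a : tangent_image pinched_sphere x (figure8_diff false u a).
  exists (stereo_chart false); split; [by exists false|exact: d0|].
  by exists a; rewrite pinched_sphere_stereo derive_figure8_stereo /= eu.
have ty a : tangent_image pinched_sphere y (figure8_diff false (vec2 (- u ord0 ord0) 0) a).
  exists (stereo_chart false); split; [by exists false|exact: d0'|].
  by exists a; rewrite pinched_sphere_stereo derive_figure8_stereo /= yu.
set U := u ord0 ord0 in u0 yu Dy ty; set D := plane_den u in D0 Dy.
(* At (U, 0) and (- U, 0) the differentials send (p, q) to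
   (4 U q / D^2, 2 q / D, - 4 U p / D^2) and (- 4 U q / D^2, 2 q / D, 4 U p / D^2);
   the vectors (p, q1) and (0, q2) solve the resulting linear system. *)
pose p := - (w ord0 iz * D ^+ 2 / (4 * U)).
pose q1 := (w ord0 ix * D ^+ 2 / (4 * U) + w ord0 iy * D / 2) / 2.
pose q2 := (w ord0 iy * D / 2 - w ord0 ix * D ^+ 2 / (4 * U)) / 2.
exists (figure8_diff false u (vec2 p q1)),
  (figure8_diff false (vec2 (- U) 0) (vec2 0 q2)); split=> //.
apply: rV3P; rewrite mxE /figure8_diff !vec2E Dy u1 -/U -/D !vec3E /p /q1 /q2 /psign
  ?expr0; field; by rewrite ?u0 ?D0.
Qed.

(** Two preimages of a double point are opposite in x, and three numbers cannot be
    pairwise opposite unless they vanish. *)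
Lemma pinched_sphere_no_triple (x y z : S2) : ~ triple_tuple pinched_sphere x y z.
Proof.
move=> [/pinched_sphere_double[_ _ yx _ x0] /pinched_sphere_double[_ _ zx _ _]].
move=> /pinched_sphere_double[_ _ zy _ _].
by move/eqP: x0; apply; lra.
Qed.

Lemma pinched_sphere_generic : generic_map pinched_sphere.
Proof.
split.
- exact: pinched_sphere_smooth.
- move=> x; have [x0|x0] := eqVneq (pt x ord0 ix) 0; last first.
    by left; apply: pinched_sphere_immersed; left.
  have [y0|y0] := eqVneq (pt x ord0 iy) 0; last first.
    by left; apply: pinched_sphere_immersed; right.
  by right; exact: pinched_sphere_pole.
- move=> x y xy; have [_ _ y0 _ x0] := pinched_sphere_double xy; split.
  + by apply: pinched_sphere_immersed; left.
  + by apply: pinched_sphere_immersed; left; rewrite y0 oppr_eq0.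
  + exact: pinched_sphere_transverse.
- by move=> x y z /pinched_sphere_no_triple.
- by move=> x y z t /pinched_sphere_no_triple.
Qed.

Definition pinched_diagram : virtual_2knot_diagram R.
Proof.
refine (@Virtual2KnotDiagram R sphere_surface pinched_sphere pinched_sphere_generic
  (fun _ _ => Virtual) _ _ _).
- by [].
- by move=> x y _; apply: filterE => p.
- by move=> x y z /pinched_sphere_no_triple.
Defined.

End pinched_sphere.

(** * Fibers over a virtual branch point *)

Section angles.
Context {R : realType}.

Lemma angleE (t : R) : (angle t ord0 ord0 = cos t) * (angle t ord0 ord_max = sin t).
Proof. by rewrite !mxE. Qed.

Lemma angle_circle (t : R) : circle (angle t).
Proof. by rewrite /circle/= !angleE cos2Dsin2. Qed.

Lemma angle_periodic : periodic (@angle R) (pi *+ 2).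
Proof. by move=> t; apply: rV2P; rewrite !angleE ?cosD2pi ?sinD2pi. Qed.

Lemma angle_surj (s : 'rV[R]_2) : circle s -> exists t, angle t = s.
Proof.
rewrite /circle/= => cs; set x := s ord0 ord0 in cs; set y := s ord0 ord_max in cs.
have x1 : -1 <= x <= 1 by apply/andP; split; nra.
have cx : cos (acos x) = x by apply: acosK; rewrite in_itv.
have sx : sin (acos x) = `|y|.
  by rewrite sin_acos// -sqrtr_sqr; congr Num.sqrt; lra.
have [y0|y0] := lerP 0 y.
  by exists (acos x); apply: rV2P; rewrite angleE ?cx ?sx ?ger0_norm.
by exists (- acos x); apply: rV2P; rewrite angleE ?cosN ?sinN ?cx ?sx ?ltr0_norm ?opprK.
Qed.

(** With h = (t - s) / 2 in ]0, pi[, equal angles would give cos (2h) = 1, whence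
    sin h = 0. *)
Lemma angle_inj (s t : R) : s < t < s + pi *+ 2 -> angle s <> angle t.
Proof.
move=> /andP[st ts] e.
have := congr1 (fun u : 'rV[R]_2 => u ord0 ord0) e.
have := congr1 (fun u : 'rV[R]_2 => u ord0 ord_max) e.
rewrite /= !angleE => es ec.
pose h := (t - s) / 2.
have sh : 0 < sin h by apply: sin_gt0_pi; rewrite /h; lra.
have : cos (t - s) = 1 by rewrite cosB es ec -!expr2 cos2Dsin2.
rewrite (_ : t - s = h *+ 2); last by rewrite /h; lra.
by rewrite cos_mulr2n; have := cos2Dsin2 h; nra.
Qed.

End angles.

Section no_covering.
Context {R : realType}.
Local Notation plane := 'rV[R]_2.

Lemma derive_pair (V W1 W2 : normedModType R) (f : V -> W1 * W2) (x v : V) :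
  derivable f x v ->
  [/\ (fun h : R => h^-1 *: ((f (h *: v + x)).1 - (f x).1)) @ 0^' --> ('D_v f x).1,
      derivable (fun y => (f y).2) x v &
      'D_v (fun y => (f y).2) x = ('D_v f x).2].
Proof.
move=> df; have cf : h^-1 *: (f (h *: v + x) - f x) @[h --> 0^'] --> 'D_v f x by exact: df.
have c1 : (h^-1 *: (f (h *: v + x) - f x)).1 @[h --> 0^'] --> ('D_v f x).1.
  by apply: (cvg_comp _ _ cf); exact: cvg_fst.
have c2 : (h^-1 *: (f (h *: v + x) - f x)).2 @[h --> 0^'] --> ('D_v f x).2.
  by apply: (cvg_comp _ _ cf); exact: cvg_snd.
split; [exact: c1| |].
  by apply/cvg_ex; exists ('D_v f x).2; exact: c2.
by apply: cvg_lim; [exact: norm_hausdorff|exact: c2].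
Qed.

(** The circles over the points with stereographic coordinates (e / 2, 0) and
    (- e / 2, 0), which have the same image, are close enough to the circle over the
    pole to wind oddly about a common point, yet lie outside each other. *)
Lemma no_covering phi : ~ fiber_circle_covering (alpha := pinched_diagram (R := R)) phi.
Proof.
case=> -[smooth immersion inj _] fib _ virt.
pose Phi (p : plane * R) := phi (stereo_pt false p.1, angle p.2).
have a_in : atlas (c := sphere_surface (R := R)) (stereo_chart false) by exists false.
have Ck_Phi k : Ck k [set p : plane * R | setT p.1] Phi.
  exact: (smooth (stereo_chart false) a_in k).
have cPhi : continuous Phi.
  by move=> p; exact: (Ck_continuous (Ck_Phi 0)).
(* the fiber circle over the point with stereographic coordinates u, parametrized
   by the angle; the branch point is u = 0 *)
pose G u t : plane := (Phi (u, t)).2.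
have cG : continuous (fun p : plane * R => G p.1 p.2).
  move=> p; apply: (@continuous_comp _ _ _ Phi snd); last exact: cvg_snd.
  exact: cPhi.
have pG u : periodic (G u) (pi *+ 2).
  by move=> t; rewrite /G /Phi /= angle_periodic.
have cGu u : continuous (G u).
  move=> t; apply: (@continuous_comp _ _ _ (fun t => (u, t))
                                           (fun p : plane * R => G p.1 p.2)).
    by apply: continuous_pair; [exact: cst_continuous|exact: cvg_id].
  exact: cG.
have Phi1 u t : (Phi (u, t)).1 = pinched_sphere (stereo_pt false u).
  by apply: fib; exact: angle_circle.
have injG s t : s < t < s + pi *+ 2 -> G 0 s <> G 0 t.
  move=> st e; apply: (angle_inj st).
  have ePhi : Phi (0, s) = Phi (0, t).
    by rewrite [LHS]surjective_pairing [RHS]surjective_pairing !Phi1; congr pair.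
  have := inj (stereo_pt false 0, angle s) (stereo_pt false 0, angle t).
  by rewrite !inE => /(_ (conj I (angle_circle s)) (conj I (angle_circle t)) ePhi) [].
(* The velocity of Phi along a fiber is nonzero and its first component vanishes. *)
have dG t : derivable (G 0) t 1 /\ 'D_1 (G 0) t <> 0.
  have [_ /(_ (0, 1))[dPhi _]] := Ck_Phi 1%N.
  have [c1 d2 e2] := derive_pair (dPhi (0, t) I).
  have line h : h *: (0, 1) + (0, t) = (0, h *: 1 + t) :> plane * R.
    by rewrite [LHS]surjective_pairing; congr pair; rewrite /= ?scaler0 ?addr0.
  have Gline : (fun h : R => h^-1 *: (G 0 (h *: 1 + t) - G 0 t)) =
     (fun h : R => h^-1 *: ((Phi (h *: (0, 1) + (0, t))).2 - (Phi (0, t)).2)).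
    by apply/funext => h; rewrite line.
  have D1 : ('D_(0, 1) Phi (0, t)).1 = 0.
    apply: (cvg_unique _ c1); first exact: norm_hausdorff.
    rewrite (_ : (fun h => _) = cst 0); first exact: cvg_cst.
    by apply/funext => h; rewrite line !Phi1 subrr scaler0.
  split; first by rewrite /derivable Gline; exact: d2.
  rewrite /derive Gline => e0.
  have := immersion (stereo_chart false) 0 t a_in I (0, 1).
  have -> : 'D_(0, 1) (fun p : plane * R =>
      phi (cfrom (stereo_chart false) p.1, angle p.2)) (0, t) = 0.
    rewrite [LHS]surjective_pairing; congr pair; first exact: D1.
    by rewrite -[RHS]e0 -e2.
  by move=> /(_ erefl) [] /eqP; rewrite oner_eq0.
have [z [z0 nz]] := embedded_loop_odd_winding (cGu 0) (pG 0) injG dG.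
have cGz : continuous (fun p : plane * R => G p.1 p.2 - z).
  by move=> p; apply: cvgB; [exact: cG|exact: cvg_cst].
have pGz u : periodic (fun t => G u t - z) (pi *+ 2) by move=> t; rewrite pG.
have := @even_winding_near R plane (fun u t => G u t - z) 0 cGz pGz z0.
move=> /nbhs_ballP[e /= e0 He].
(* the two preimages of a double point close to the branch point *)
pose u b : plane := vec2 (psign b * (e / 2)) 0.
have {He} [Hz Hn] : (forall b t, G (u b) t - z <> 0) /\
                    (forall b, ~ even_winding (fun t => G (u b) t - z)).
  have near b : ball (0 : plane) e (u b).
    rewrite -ball_normE /= sub0r normrN /Num.Def.normr/= mx_normrE.
    apply: bigmax_lt => // -[i j] _ /=; rewrite (ord1E i); move: j.
    apply: (ord2P (P := fun j => `|u b ord0 j| < e)); rewrite vec2E ?normr0//.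
    by rewrite normrM normrX normrN1 expr1n mul1r gtr0_norm; lra.
  by split=> b; have [h1 h2] := He _ (near b); [exact: h1|move/h2].
have fibE v : fiber_circle phi (stereo_pt false v) = range (G v).
  apply/seteqP; split=> w.
    by move=> [s /angle_surj[t <-] <-]; exists t.
  by move=> [t _ <-]; exists (angle t) => //; exact: angle_circle.
have ins b : inside (range (G (u b))) z.
  have nr : ~ range (G (u b)) z by move=> [t _ gt]; apply: (Hz b t); rewrite gt subrr.
  split=> //; apply: contrapT => unb; apply: (Hn b).
  exact: even_winding_unbounded.
have cl b : closed (range (G (u b))) by exact: closed_range_loop.
have dp : double_pair (pinched_sphere (R := R)) (stereo_pt false (u false))
                                                (stereo_pt false (u true)).
  have Du : plane_den (u true) = plane_den (u false).
    by rewrite /plane_den /u !vec2E /psign expr0 expr1 mulN1r mul1r sqrrN.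
  split.
    move=> /(congr1 pt) /(congr1 (fun p : 'rV[R]_3 => p ord0 ix)).
    rewrite /= /stereo_inv !vec3E Du !vec2E /psign expr0 expr1 => /eqP.
    rewrite -subr_eq0 -mulrBl mulf_eq0 invr_eq0 (negPf (plane_den_neq0 _)) orbF => /eqP.
    lra.
  have pE v : pinched_sphere (stereo_pt false v) = figure8_stereo false v.
    exact: figure8_stereoE.
  by rewrite !pE; apply: rV3P; rewrite /figure8_stereo !vec3E Du ?vec2E ?mulr0 ?mul0r.
have [] := virt _ _ dp erefl; rewrite !fibE => out1 out2.
exact: (mutually_outside_insides (cl false) (cl true) out1 out2 (ins false) (ins true)).
Qed.

End no_covering.

Theorem theorem6p23 (R : realType) :
  ~ (forall alpha : virtual_2knot_diagram R,
       exists phi : surface alpha * 'rV[R]_2 -> 'rV[R]_3 * 'rV[R]_2,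
         fiber_circle_covering phi).
Proof. by move=> /(_ pinched_diagram)[phi]; exact: no_covering. Qed.
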